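(* Let $\mathcal C$ be a strict rigid category. The following sets are in bijection: (i) the set $\mathrm{QPiv}(\mathcal C)$ of equivalence classes of quasi-pivotal structures on $\mathcal C$, (ii) the Picard heap $\mathrm{Pic}\,\mathsf A(\mathcal C)$ of the anti-Drinfeld centre $\mathsf A(\mathcal C)$, i.e. the set of isomorphism classes (in $\mathsf A(\mathcal C)$) of $\mathcal C$-invertible objects of $\mathsf A(\mathcal C)$, and (iii) the set of isomorphism classes of equivalences of left $\mathsf Z(\mathcal C)$-module categories from $\mathsf Z(\mathcal C)$ to $\mathsf A(\mathcal C)$.
   Context: Monoidal categories are strict. A rigid category (every object has a left dual $X^\vee$ and a right dual ${}^\vee X$, with a fixed choice) is strict rigid if the left and right dualising functors $\mathcal C\to\mathcal C^{\mathrm{op},\otimes\text{-}\mathrm{op}}$ are strict monoidal and mutually inverse. Then $(-)^{\vee\vee}\colon\mathcal C\to\mathcal C$ is a strict monoidal functor. An object is invertible if its left evaluation $\mathrm{ev}^l_X\colon X^\vee\otimes X\to 1$ and coevaluation $\mathrm{coev}^l_X\colon 1\to X\otimes X^\vee$ are isomorphisms. A quasi-pivotal structure on $\mathcal C$ is a pair $(\beta,\rho_\beta)$ of an invertible object $\beta$ and a monoidal natural isomorphism $\rho_\beta\colon\mathrm{Id}_{\mathcal C}\to\beta\otimes(-)^{\vee\vee}\otimes\beta^\vee$. Any isomorphism $\psi\colon\beta'\to\beta$ produces from $(\beta,\rho_\beta)$ the quasi-pivotal structure $(\beta',(\psi^{-1}\otimes\mathrm{id}\otimes\psi^\vee)\rho_\beta)$,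 and two quasi-pivotal structures are equivalent if related in this way; $\mathrm{QPiv}(\mathcal C)$ is the set of equivalence classes. Drinfeld centre $\mathsf Z(\mathcal C)$: objects $(X,\sigma_{X,-})$ with $\sigma_{X,Y}\colon X\otimes Y\to Y\otimes X$ an isomorphism natural in $Y$ with $\sigma_{X,Y\otimes W}=(\mathrm{id}_Y\otimes\sigma_{X,W})(\sigma_{X,Y}\otimes\mathrm{id}_W)$; morphisms commute with half-braidings; tensor product with $\sigma_{X\otimes X',Y}=(\sigma_{X,Y}\otimes\mathrm{id}_{X'})(\mathrm{id}_X\otimes\sigma_{X',Y})$. Anti-Drinfeld centre $\mathsf A(\mathcal C)$: objects $(A,\sigma_{A,-})$ with $\sigma_{A,Y}\colon A\otimes Y^{\vee\vee}\to Y\otimes A$ an isomorphism natural in $Y$ with $\sigma_{A,Y\otimes W}=(\mathrm{id}_Y\otimes\sigma_{A,W})(\sigma_{A,Y}\otimes\mathrm{id}_{W^{\vee\vee}})$; morphisms commute with half-braidings. $\mathsf Z(\mathcal C)$ acts from the left by $X\otimes A$ with $\sigma_{X\otimes A,Y}=(\sigma_{X,Y}\otimes\mathrm{id}_A)(\mathrm{id}_X\otimes\sigma_{A,Y})$. An object of $\mathsf A(\mathcal C)$ is $\mathcal C$-invertible if its underlying object in $\mathcal C$ is invertible. A functor of left $\mathsf Z(\mathcal C)$-module categories is a functor $F$ with a natural isomorphism $\delta_{X,M}\colon F(X\otimes M)\to X\otimes F(M)$ satisfying $\delta_{X\otimes Y,M}=(\mathrm{id}_X\otimes\delta_{Y,M})\delta_{X,Y\otimes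 M}$ and $\delta_{1,M}=\mathrm{id}$; it is an equivalence of module categories if $F$ is an equivalence of categories. Isomorphism classes of such functors are taken with respect to natural isomorphism. $\mathsf Z(\mathcal C)$ is a left module over itself via its tensor product. *)

(* Defs.v *)
From mathcomp Require Import all_boot.
From mathcomp Require Import boolp.

Set Implicit Arguments.
Unset Strict Implicit.
Unset Printing Implicit Defensive.

Declare Scope cat_scope.
Delimit Scope cat_scope with cat.
Local Open Scope cat_scope.

Record category := Category {
  ob :> Type;
  hom : ob -> ob -> Type;
  idm : forall X, hom X X;
  cmp : forall X Y Z, hom Y Z -> hom X Y -> hom X Z;
  cmp1m : forall X Y (f : hom X Y), cmp (idm Y) f = f;
  cmpm1 : forall X Y (f : hom X Y), cmp f (idm X) = f;
  cmpA : forall X Y Z W (h : hom Z W) (g : hom Y Z) (f : hom X Y),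
    cmp h (cmp g f) = cmp (cmp h g) f }.

Arguments hom {c} _ _.
Arguments idm {c} X.
Arguments cmp {c X Y Z} _ _.

Notation "g ∘ f" := (cmp g f) (at level 40, left associativity) : cat_scope.

Definition inverses (C : category) (X Y : C) (f : hom X Y) (g : hom Y X) :=
  g ∘ f = idm X /\ f ∘ g = idm Y.

Definition is_iso (C : category) (X Y : C) (f : hom X Y) :=
  exists g : hom Y X, inverses f g.

Record functor (C D : category) := Functor {
  fob :> C -> D;
  fmap : forall X Y : C, hom X Y -> hom (fob X) (fob Y);
  fmap_id : forall X, fmap (idm X) = idm (fob X);
  fmap_cmp : forall X Y Z (g : hom Y Z) (f : hom X Y),
    fmap (g ∘ f) = fmap g ∘ fmap f }.

Definition idF (C : category) : functor C C :=
  @Functor C C id (fun _ _ => id) (fun _ => erefl) (fun _ _ _ _ _ => erefl).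

Definition compF (C D E : category) (G : functor D E) (F : functor C D) :
    functor C E :=
  @Functor C E (fun X => G (F X)) (fun X Y f => fmap G (fmap F f))
    (fun X => etrans (congr1 (@fmap _ _ G _ _) (fmap_id F X)) (fmap_id G (F X)))
    (fun X Y Z g f =>
      etrans (congr1 (@fmap _ _ G _ _) (fmap_cmp F g f)) (fmap_cmp G _ _)).

Definition nat_iso (C D : category) (F G : functor C D) : Prop :=
  exists eta : forall X : C, hom (F X) (G X),
    (forall X Y (f : hom X Y), eta Y ∘ fmap F f = fmap G f ∘ eta X) /\
    (forall X, is_iso (eta X)).

Definition is_equivalence (C D : category) (F : functor C D) : Prop :=
  exists G : functor D C,
    nat_iso (compF G F) (idF C) /\ nat_iso (compF F G) (idF D).

(* In a strict monoidal category objects such as [X ⊗ (Y ⊗ Z)] and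
   [(X ⊗ Y) ⊗ Z] are equal, but not convertible, so that morphisms which are
   equal on paper may have types that are only provably equal.  We compare such
   morphisms as arrows, i.e. together with their domain and codomain; for
   parallel morphisms this is plain equality ([arrow_inj]).  Dually, [cmpE] and
   [hcast] compose and retype morphisms along equalities between objects. *)

Record arrow (C : category) := Arrow { dom : C; cod : C; amor : hom dom cod }.
Arguments Arrow {C dom cod} _.

Notation "f ≡ g" := (Arrow f = Arrow g) (at level 70) : cat_scope.

Definition hcast (C : category) (X X' Y Y' : C) (f : hom X Y)
    (eX : X = X') (eY : Y = Y') : hom X' Y' :=
  match eX in _ = X', eY in _ = Y' return hom X' Y' with
  | erefl, erefl => f
  end.
Arguments hcast {C X X' Y Y'} & f eX eY.

Definition cmpE (C : category) (X Y Y' Z : C) (g : hom Y' Z) (f : hom X Y)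
    (e : Y = Y') : hom X Z := g ∘ hcast f erefl e.

Record smcat := SMCat {
  smcat_cat :> category;
  tens : smcat_cat -> smcat_cat -> smcat_cat;
  tunit : smcat_cat;
  tensm : forall X X' Y Y' : smcat_cat,
    hom X X' -> hom Y Y' -> hom (tens X Y) (tens X' Y');
  tensm_id : forall X Y, tensm (idm X) (idm Y) = idm (tens X Y);
  tensm_cmp : forall X X' X'' Y Y' Y'' (f' : hom X' X'') (f : hom X X')
      (g' : hom Y' Y'') (g : hom Y Y'),
    tensm (f' ∘ f) (g' ∘ g) = tensm f' g' ∘ tensm f g;
  tensA : forall X Y Z, tens X (tens Y Z) = tens (tens X Y) Z;
  tens1o : forall X, tens tunit X = X;
  tenso1 : forall X, tens X tunit = X;
  tensmA : forall X X' Y Y' Z Z' (f : hom X X') (g : hom Y Y') (h : hom Z Z'),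
    tensm f (tensm g h) ≡ tensm (tensm f g) h;
  tensm1f : forall X X' (f : hom X X'), tensm (idm tunit) f ≡ f;
  tensmf1 : forall X X' (f : hom X X'), tensm f (idm tunit) ≡ f }.

Arguments tens {s} _ _.
Arguments tunit {s}.
Arguments tensm {s X X' Y Y'} _ _.

Notation "X ⊗ Y" := (tens X Y) (at level 38, left associativity) : cat_scope.
Notation "f ⊠ g" := (tensm f g) (at level 38, left associativity) : cat_scope.
Notation "𝟙" := tunit : cat_scope.

(* [strict] proves the equalities of objects that hold in every strict monoidal
   category; [g ⊚ f] and [⟦ f ⟧] leave these equalities implicit. *)
Ltac strict := by rewrite ?tensA ?tens1o ?tenso1.

Notation "g ⊚ f" := (cmpE g f ltac:(strict))
  (at level 40, left associativity, only parsing) : cat_scope.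
Notation "⟦ f ⟧" := (hcast f ltac:(strict) ltac:(strict))
  (only parsing) : cat_scope.

(* Arrows have a strictly associative total tensor product [tA] and a
   composition [cA], whose value on non-composable arrows is irrelevant.  They
   are only used in the proofs below. *)

Section ArrowCategory.
Variable C : category.
Implicit Types a b c : arrow C.

Lemma arrow_inj (X Y : C) (f g : hom X Y) : f ≡ g -> f = g.
Proof.
have H (a b : arrow C) (e : a = b) :
    amor b = hcast (amor a) (congr1 (@dom C) e) (congr1 (@cod C) e).
  by case: b / e.
move=> fg; rewrite [RHS](H _ _ fg) /=; set e1 := congr1 _ _; set e2 := congr1 _ _.
by rewrite (Prop_irrelevance e1 erefl) (Prop_irrelevance e2 erefl).
Qed.

Lemma arrow_hcast (X X' Y Y' : C) (f : hom X Y) (eX : X = X') (eY : Y = Y') :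
  Arrow (hcast f eX eY) = Arrow f.
Proof. by case: X' / eX; case: Y' / eY. Qed.

Definition cA a b : arrow C :=
  if pselect (cod b = dom a) is left e then Arrow (cmpE (amor a) (amor b) e)
  else b.

Definition iA (X : C) := Arrow (idm X).

Lemma arrow_cmpE (X Y Y' Z : C) (g : hom Y' Z) (f : hom X Y) (e : Y = Y') :
  Arrow (cmpE g f e) = cA (Arrow g) (Arrow f).
Proof.
rewrite /cA; case: pselect => //= e'.
by rewrite (Prop_irrelevance e e').
Qed.

Lemma arrow_cmp (X Y Z : C) (g : hom Y Z) (f : hom X Y) :
  Arrow (g ∘ f) = cA (Arrow g) (Arrow f).
Proof. by rewrite -(arrow_cmpE _ _ erefl). Qed.

Lemma dom_cA a b : cod b = dom a -> dom (cA a b) = dom b.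
Proof. by rewrite /cA; case: pselect. Qed.

Lemma cod_cA a b : cod b = dom a -> cod (cA a b) = cod a.
Proof. by rewrite /cA; case: pselect. Qed.

Lemma cA_assoc a b c : cod b = dom a -> cod c = dom b ->
  cA a (cA b c) = cA (cA a b) c.
Proof.
case: a b c => [Z' W h] [Y' Z g] [X Y f] /= eZ eY.
case: Z' / eZ h => h; case: Y' / eY g => g.
by rewrite -!arrow_cmp cmpA.
Qed.

Lemma cA1a a X : cod a = X -> cA (iA X) a = a.
Proof. by move=> <-; case: a => Y Z f /=; rewrite -arrow_cmp cmp1m. Qed.

Lemma cAa1 a X : dom a = X -> cA a (iA X) = a.
Proof. by move=> <-; case: a => Y Z f /=; rewrite -arrow_cmp cmpm1. Qed.

End ArrowCategory.

Section ArrowMonoidal.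
Variable C : smcat.
Implicit Types a b c : arrow C.

Definition tA a b : arrow C := Arrow (amor a ⊠ amor b).

Lemma arrow_tens (X X' Y Y' : C) (f : hom X X') (g : hom Y Y') :
  Arrow (f ⊠ g) = tA (Arrow f) (Arrow g).
Proof. by []. Qed.

Lemma tAA a b c : tA a (tA b c) = tA (tA a b) c.
Proof. exact: tensmA. Qed.

Lemma tA1a a : tA (iA 𝟙) a = a.
Proof. by case: a => X Y f; apply: tensm1f. Qed.

Lemma tAa1 a : tA a (iA 𝟙) = a.
Proof. by case: a => X Y f; apply: tensmf1. Qed.

Lemma tA_id (X Y : C) : tA (iA X) (iA Y) = iA (X ⊗ Y).
Proof. by rewrite /tA tensm_id. Qed.

Lemma tA_cA a b a' b' : cod b = dom a -> cod b' = dom a' ->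
  tA (cA a b) (cA a' b') = cA (tA a a') (tA b b').
Proof.
case: a b a' b' => [Y' Z g] [X Y f] [V' W k] [U V h] /= eY eV.
case: Y' / eY g => g; case: V' / eV k => k.
by rewrite -!arrow_cmp -!arrow_tens tensm_cmp arrow_cmp.
Qed.

Lemma tA_cAl a b (X : C) : cod b = dom a ->
  tA (cA a b) (iA X) = cA (tA a (iA X)) (tA b (iA X)).
Proof. by move=> e; rewrite -tA_cA // cA1a. Qed.

Lemma tA_cAr a b (X : C) : cod b = dom a ->
  tA (iA X) (cA a b) = cA (tA (iA X) a) (tA (iA X) b).
Proof. by move=> e; rewrite -tA_cA // cA1a. Qed.

Lemma dom_tA a b : dom (tA a b) = dom a ⊗ dom b. Proof. by []. Qed.
Lemma cod_tA a b : cod (tA a b) = cod a ⊗ cod b. Proof. by []. Qed.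

Lemma tA_slide a b :
  cA (tA a (iA (cod b))) (tA (iA (dom a)) b) =
  cA (tA (iA (cod a)) b) (tA a (iA (dom b))).
Proof. by rewrite -!tA_cA // !cA1a // !cAa1. Qed.

End ArrowMonoidal.

Ltac arr :=
  rewrite ?(arrow_hcast, arrow_cmpE, arrow_cmp, arrow_tens) -?/(iA _).

Ltac dc := repeat (rewrite ?dom_tA ?cod_tA /=;
  (rewrite dom_cA || rewrite cod_cA || idtac)); rewrite /= ?dom_cA ?cod_cA /=;
  rewrite ?tensA ?tens1o ?tenso1 //=.

Definition op_cat (C : category) : category :=
  @Category C (fun X Y => @hom C Y X) (fun X => idm X)
    (fun X Y Z g f => f ∘ g)
    (fun X Y f => cmpm1 f) (fun X Y f => cmp1m f)
    (fun X Y Z W h g f => esym (cmpA f g h)).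

Definition op_arrow (C : category) (a : arrow C) : arrow (op_cat C) :=
  @Arrow (op_cat C) (cod a) (dom a) (amor a).

(* [C] with opposite composition and opposite tensor product. *)
Definition optop (C : smcat) : smcat :=
  @SMCat (op_cat C) (fun X Y => Y ⊗ X) 𝟙 (fun X X' Y Y' f g => g ⊠ f)
    (fun X Y => tensm_id Y X)
    (fun X X' X'' Y Y' Y'' f' f g' g => tensm_cmp g g' f f')
    (fun X Y Z => esym (tensA Z Y X)) (@tenso1 C) (@tens1o C)
    (fun X X' Y Y' Z Z' f g h => congr1 (@op_arrow C) (esym (tensmA h g f)))
    (fun X X' f => congr1 (@op_arrow C) (tensmf1 f))
    (fun X X' f => congr1 (@op_arrow C) (tensm1f f)).

(* Objects and morphisms are preserved on the nose; the structure isomorphisms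
   of such a functor are identities. *)
Definition strict_monoidal (C D : smcat) (F : functor C D) : Prop :=
  [/\ F 𝟙 = 𝟙,
      forall X Y : C, F (X ⊗ Y) = F X ⊗ F Y
    & forall (X X' Y Y' : C) (f : hom X X') (g : hom Y Y'),
        fmap F (f ⊠ g) ≡ fmap F f ⊠ fmap F g].

(* [X^∨] is the left dual of [X], [rdual X] its right dual. *)
Record rigidcat := RigidCat {
  rigid_smcat :> smcat;
  ldual : rigid_smcat -> rigid_smcat;
  evl : forall X, hom (ldual X ⊗ X) 𝟙;
  coevl : forall X, hom 𝟙 (X ⊗ ldual X);
  snakel1 : forall X,
    (idm X ⊠ evl X) ⊚ (coevl X ⊠ idm X) ≡ idm X;
  snakel2 : forall X,
    (evl X ⊠ idm (ldual X)) ⊚ (idm (ldual X) ⊠ coevl X) ≡ idm (ldual X);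
  rdual : rigid_smcat -> rigid_smcat;
  evr : forall X, hom (X ⊗ rdual X) 𝟙;
  coevr : forall X, hom 𝟙 (rdual X ⊗ X);
  snaker1 : forall X,
    (evr X ⊠ idm X) ⊚ (idm X ⊠ coevr X) ≡ idm X;
  snaker2 : forall X,
    (idm (rdual X) ⊠ evr X) ⊚ (coevr X ⊠ idm (rdual X)) ≡ idm (rdual X) }.

Arguments ldual {r} X.
Arguments rdual {r} X.
Arguments evl {r} X.
Arguments coevl {r} X.
Arguments evr {r} X.
Arguments coevr {r} X.

Notation "X ^∨" := (ldual X) (at level 2, left associativity, format "X ^∨")
  : cat_scope.

Section Dualising.
Variable C : rigidcat.

Definition ldualm (X Y : C) (f : hom X Y) : hom Y^∨ X^∨ :=
  ⟦ (evl Y ⊠ idm X^∨) ⊚ (idm Y^∨ ⊠ f ⊠ idm X^∨) ⊚ (idm Y^∨ ⊠ coevl X) ⟧.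

Definition rdualm (X Y : C) (f : hom X Y) : hom (rdual Y) (rdual X) :=
  ⟦ (idm (rdual X) ⊠ evr Y) ⊚ (idm (rdual X) ⊠ f ⊠ idm (rdual Y))
    ⊚ (coevr X ⊠ idm (rdual Y)) ⟧.

End Dualising.
Section DualLemmas.
Variable C : rigidcat.

Lemma ldualm_ev (X Y : C) (f : hom X Y) :
  evl X ∘ (ldualm f ⊠ idm X) = evl Y ∘ (idm Y^∨ ⊠ f).
Proof.
apply: arrow_inj; arr.
rewrite !tA_cAl; [|dc..].
have S1 := tA_slide (Arrow (evl Y)) (Arrow (evl X)); rewrite /= tA1a tAa1 in S1.
have S2 := tA_slide (Arrow f) (Arrow (evl X)); rewrite /= tAa1 in S2.
have S3 := snakel1 X; move: S3; arr => S3.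
rewrite -![in LHS]tAA tA_id.
rewrite [LHS]cA_assoc; [|dc..].
rewrite [in LHS]cA_assoc; [|dc..].
rewrite -S1 -[in LHS]cA_assoc; [|dc..].
rewrite -tA_id -[tA (tA _ _) (Arrow (evl X))]tAA -(tA_cAr Y^∨); [|dc..].
rewrite -cA_assoc; [|dc..].
rewrite -(tA_cAr Y^∨); [|dc..].
rewrite [cA (tA (iA Y) _) _]cA_assoc; [|dc..].
rewrite -S2 -[cA (cA (Arrow f) _) _]cA_assoc; [|dc..].
by rewrite S3 cAa1.
Qed.

Lemma ldualm_id (X : C) : ldualm (idm X) = idm X^∨.
Proof.
apply: arrow_inj; arr; rewrite !tA_id.
have S3 := snakel2 X; move: S3; arr => S3.
rewrite cAa1 //; dc.
Qed.

Lemma ldualm_cmp (X Y Z : C) (g : hom Y Z) (f : hom X Y) :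
  ldualm (g ∘ f) = ldualm f ∘ ldualm g.
Proof.
apply: arrow_inj.
have := congr1 (@Arrow C _ _) (ldualm_ev g).
move: (ldualm g) => h; arr => H.
have S1 := tA_slide (Arrow h) (Arrow (coevl X)); rewrite /= tAa1 in S1.
have S2 := tA_slide (Arrow h) (tA (Arrow f) (iA X^∨)); rewrite /= !tAA in S2.
rewrite -[RHS]cA_assoc; [|dc..].
rewrite -{}S1 [RHS]cA_assoc; [|dc..].
rewrite -[in RHS](cA_assoc (b := tA (tA _ _) _)); [|dc..].
rewrite -{}S2 -tA_id tAA [in RHS]cA_assoc; [|dc..].
rewrite -!(tA_cAl X^∨); [|dc..].
by rewrite H tA_cAr // -cA_assoc; [|dc..].
Qed.

Lemma rdualm_ev (X Y : C) (f : hom X Y) :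
  evr X ∘ (idm X ⊠ rdualm f) = evr Y ∘ (f ⊠ idm (rdual Y)).
Proof.
apply: arrow_inj; arr.
rewrite !tA_cAr; [|dc..].
have S1 := tA_slide (Arrow (evr X)) (Arrow (evr Y)); rewrite /= tA1a tAa1 in S1.
have S2 := tA_slide (Arrow (evr X)) (Arrow f); rewrite /= tA1a in S2.
have S3 := snaker1 X; move: S3; arr => S3.
rewrite ![in LHS]tAA tA_id.
rewrite [LHS]cA_assoc; [|dc..].
rewrite [in LHS]cA_assoc; [|dc..].
rewrite S1 -[in LHS]cA_assoc; [|dc..].
rewrite -tA_id.
rewrite [tA (Arrow (evr X)) _]tAA -[in LHS](cA_assoc (c := cA _ _)); [|dc..].
rewrite -!(tA_cAl (rdual Y)); [|dc..].
rewrite [cA (tA _ (iA Y)) _]cA_assoc; [|dc..].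
rewrite S2 -[cA (cA (Arrow f) _) _]cA_assoc; [|dc..].
by rewrite S3 cAa1.
Qed.

Lemma rdualm_id (X : C) : rdualm (idm X) = idm (rdual X).
Proof.
apply: arrow_inj; arr; rewrite !tA_id.
have S3 := snaker2 X; move: S3; arr => S3.
rewrite cAa1 //; dc.
Qed.

Lemma rdualm_cmp (X Y Z : C) (g : hom Y Z) (f : hom X Y) :
  rdualm (g ∘ f) = rdualm f ∘ rdualm g.
Proof.
apply: arrow_inj.
have := congr1 (@Arrow C _ _) (rdualm_ev g).
move: (rdualm g) => h; arr => H.
have S1 := tA_slide (Arrow (coevr X)) (Arrow h); rewrite /= tA1a in S1.
have S2 := tA_slide (tA (iA (rdual X)) (Arrow f)) (Arrow h); rewrite /= in S2.
rewrite -[RHS]cA_assoc; [|dc..].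
rewrite {}S1 [RHS]cA_assoc; [|dc..].
rewrite -[in RHS](cA_assoc (b := tA (tA _ _) _)); [|dc..].
rewrite {}S2 -tA_id [in RHS]cA_assoc; [|dc..].
rewrite -![tA (tA (iA (rdual X)) _) _]tAA.
rewrite -!(tA_cAr (rdual X)); [|dc..].
by rewrite H tA_cAl // -cA_assoc; [|dc..].
Qed.

End DualLemmas.

Definition ldualF (C : rigidcat) : functor C (optop C) :=
  @Functor C (optop C) ldual (@ldualm C) (@ldualm_id C) (@ldualm_cmp C).

Definition rdualF (C : rigidcat) : functor C (optop C) :=
  @Functor C (optop C) rdual (@rdualm C) (@rdualm_id C) (@rdualm_cmp C).

Record strict_rigidcat := StrictRigidCat {
  strict_rigid_rigidcat :> rigidcat;
  ldualF_strict : strict_monoidal (ldualF strict_rigid_rigidcat);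
  rdualF_strict : strict_monoidal (rdualF strict_rigid_rigidcat);
  ldualK : forall X : strict_rigid_rigidcat, rdual X^∨ = X;
  rdualK : forall X : strict_rigid_rigidcat, (rdual X)^∨ = X;
  ldualmK : forall (X Y : strict_rigid_rigidcat) (f : hom X Y),
    rdualm (ldualm f) ≡ f;
  rdualmK : forall (X Y : strict_rigid_rigidcat) (f : hom X Y),
    ldualm (rdualm f) ≡ f }.

Record smfunctor (C D : smcat) := SMFunctor {
  smfunctor_functor :> functor C D;
  smfunctor_strict : strict_monoidal smfunctor_functor }.

Lemma idF_strict (C : smcat) : strict_monoidal (idF C : functor C C).
Proof. by []. Qed.

Definition idSF (C : smcat) : smfunctor C C := SMFunctor (idF_strict C).

Definition bidualF (C : rigidcat) : functor C C :=
  @Functor C C (fun X => X^∨^∨) (fun X Y f => ldualm (ldualm f))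
    (fun X => etrans (congr1 (@ldualm C _ _) (ldualm_id X)) (ldualm_id X^∨))
    (fun X Y Z g f =>
      etrans (congr1 (@ldualm C _ _) (ldualm_cmp g f)) (ldualm_cmp _ _)).

Lemma bidualF_strict (C : strict_rigidcat) : strict_monoidal (bidualF C).
Proof.
have [l1 lM lmM] := ldualF_strict C; rewrite /= in l1 lM lmM.
have lmME (X X' Y Y' : C) (f : hom X X') (g : hom Y Y') :
    ldualm (f ⊠ g) ≡ ldualm g ⊠ ldualm f.
  exact: (congr1 (fun a : arrow (op_cat C) =>
    @Arrow C (cod a) (dom a) (amor a)) (lmM _ _ _ _ f g)).
split=> /= [|X Y|X X' Y Y' f g]; first by rewrite !l1.
  by rewrite !lM.
rewrite -lmME.
exact: (congr1 (fun a : arrow C => Arrow (ldualm (amor a))) (lmME _ _ _ _ f g)).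
Qed.

Definition bidualSF (C : strict_rigidcat) : smfunctor C C :=
  SMFunctor (bidualF_strict C).

(* The Drinfeld centre is [centre (idSF C)] and the anti-Drinfeld centre is
   [centre (bidualSF C)]. *)

Section Centre.
Variables (C : smcat) (G : smfunctor C C).

Record centre_ob := CentreOb {
  cob :> C;
  hb : forall Y : C, hom (cob ⊗ G Y) (Y ⊗ cob);
  hb_iso : forall Y, is_iso (hb Y);
  hb_nat : forall (Y Y' : C) (f : hom Y Y'),
    hb Y' ∘ (idm cob ⊠ fmap G f) = (f ⊠ idm cob) ∘ hb Y;
  hb_tens : forall Y W : C,
    hb (Y ⊗ W) ≡ (idm Y ⊠ hb W) ⊚ (hb Y ⊠ idm (G W)) }.

Record centre_hom (A B : centre_ob) := CentreHom {
  chom :> hom (cob A) (cob B);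
  chom_hb : forall Y : C,
    hb B Y ∘ (chom ⊠ idm (G Y)) = (idm Y ⊠ chom) ∘ hb A Y }.

Lemma centre_hom_inj (A B : centre_ob) (f g : centre_hom A B) :
  f = g :> hom (cob A) (cob B) -> f = g.
Proof.
case: f g => [f Hf] [g Hg] /= E; case: g / E Hg => Hg.
by rewrite (Prop_irrelevance Hf Hg).
Qed.

Lemma centre_ob_inj (A B : centre_ob) :
  A = B :> C -> (forall Y, hb A Y ≡ hb B Y) -> A = B.
Proof.
case: A B => [A hA iA nA tA] [B hB iB nB tB] /= E.
case: B / E hB iB nB tB => hB iB nB tB H.
have E : hA = hB by apply: functional_extensionality_dep => Y; exact: arrow_inj.
case: hB / E iB nB tB H => iB nB tB _.
by congr CentreOb; apply: Prop_irrelevance.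
Qed.

Lemma centre_id_hb (A : centre_ob) (Y : C) :
  hb A Y ∘ (idm (cob A) ⊠ idm (G Y)) = (idm Y ⊠ idm (cob A)) ∘ hb A Y.
Proof. by rewrite !tensm_id cmpm1 cmp1m. Qed.

Lemma centre_cmp_hb (A B D : centre_ob) (g : centre_hom B D)
    (f : centre_hom A B) (Y : C) :
  hb D Y ∘ ((chom g ∘ chom f) ⊠ idm (G Y)) =
  (idm Y ⊠ (chom g ∘ chom f)) ∘ hb A Y.
Proof.
rewrite -[idm (G Y)]cmp1m tensm_cmp cmpA chom_hb -cmpA chom_hb cmpA.
by rewrite -tensm_cmp cmp1m.
Qed.

Definition centre_idm (A : centre_ob) := CentreHom (centre_id_hb A).

Definition centre_cmp (A B D : centre_ob) (g : centre_hom B D)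
  (f : centre_hom A B) := CentreHom (centre_cmp_hb g f).

Lemma centre_cmp1m (A B : centre_ob) (f : centre_hom A B) :
  centre_cmp (centre_idm B) f = f.
Proof. by apply: centre_hom_inj; apply: cmp1m. Qed.

Lemma centre_cmpm1 (A B : centre_ob) (f : centre_hom A B) :
  centre_cmp f (centre_idm A) = f.
Proof. by apply: centre_hom_inj; apply: cmpm1. Qed.

Lemma centre_cmpA (A B D E : centre_ob) (h : centre_hom D E)
    (g : centre_hom B D) (f : centre_hom A B) :
  centre_cmp h (centre_cmp g f) = centre_cmp (centre_cmp h g) f.
Proof. by apply: centre_hom_inj; apply: cmpA. Qed.

Definition centre : category :=
  Category centre_cmp1m centre_cmpm1 centre_cmpA.

Lemma centre_arrow (A A' B B' : centre) (f : hom A B) (f' : hom A' B') :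
  A = A' -> B = B' -> chom f ≡ chom f' -> f ≡ f'.
Proof.
move=> EA EB; case: A' / EA f'; case: B' / EB => f' E.
by congr Arrow; apply: centre_hom_inj; apply: arrow_inj.
Qed.

End Centre.

Lemma is_iso_cmp (C : category) (X Y Z : C) (g : hom Y Z) (f : hom X Y) :
  is_iso g -> is_iso f -> is_iso (g ∘ f).
Proof.
move=> [g' [gK g'K]] [f' [fK f'K]]; exists (f' ∘ g'); split.
  by rewrite cmpA -[f' ∘ g' ∘ g]cmpA gK cmpm1.
by rewrite cmpA -[g ∘ f ∘ f']cmpA f'K cmpm1.
Qed.

Lemma is_iso_id (C : category) (X : C) : is_iso (idm X).
Proof. by exists (idm X); split; rewrite cmp1m. Qed.

Lemma is_iso_hcast (C : category) (X X' Y Y' : C) (f : hom X Y)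
  (eX : X = X') (eY : Y = Y') : is_iso f -> is_iso (hcast f eX eY).
Proof. by case: X' / eX; case: Y' / eY. Qed.

Lemma is_iso_tens (C : smcat) (X X' Y Y' : C) (f : hom X X') (g : hom Y Y') :
  is_iso f -> is_iso g -> is_iso (f ⊠ g).
Proof.
move=> [f' [fK f'K]] [g' [gK g'K]]; exists (f' ⊠ g').
by split; rewrite -tensm_cmp ?fK ?gK ?f'K ?g'K tensm_id.
Qed.

Section CentreAction.
Variable C : smcat.
Local Notation Z := (centre (idSF C)).

Section Action.
Variables (G : smfunctor C C).
Local Notation A := (centre G).

Definition act_hb (X : Z) (M : A) (Y : C) :
    hom ((cob X ⊗ cob M) ⊗ G Y) (Y ⊗ (cob X ⊗ cob M)) :=
  ⟦ (hb X Y ⊠ idm (cob M)) ⊚ (idm (cob X) ⊠ hb M Y) ⟧.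

Lemma act_hb_iso (X : Z) (M : A) (Y : C) : is_iso (act_hb X M Y).
Proof.
apply: is_iso_hcast; apply: is_iso_cmp; last apply: is_iso_hcast.
  by apply: is_iso_tens; [apply: hb_iso|apply: is_iso_id].
by apply: is_iso_tens; [apply: is_iso_id|apply: hb_iso].
Qed.

Lemma act_hb_nat (X : Z) (M : A) (Y Y' : C) (f : hom Y Y') :
  act_hb X M Y' ∘ (idm (cob X ⊗ cob M) ⊠ fmap G f) =
  (f ⊠ idm (cob X ⊗ cob M)) ∘ act_hb X M Y.
Proof.
have HX := congr1 (@Arrow C _ _) (hb_nat X f).
have HM := congr1 (@Arrow C _ _) (hb_nat M f).
move: HX HM; arr; rewrite /= => HX HM; apply: arrow_inj; arr.
rewrite -!tA_id tAA -[tA (tA _ _) (Arrow (fmap G f))]tAA.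
rewrite -[LHS]cA_assoc; [|dc..].
rewrite -(tA_cAr (cob X)) // HM tA_cAr // [LHS]cA_assoc; [|dc..].
rewrite [tA (iA (cob X)) (tA _ _)]tAA -(tA_cAl (cob M)) // HX tA_cAl //.
by rewrite -[LHS]cA_assoc; [|dc..].
Qed.

Lemma act_hb_tens (X : Z) (M : A) (Y W : C) e :
  act_hb X M (Y ⊗ W) ≡
  cmpE (idm Y ⊠ act_hb X M W) (act_hb X M Y ⊠ idm (G W)) e.
Proof.
have HX := hb_tens X Y W; have HM := hb_tens M Y W.
move: HX HM; arr; rewrite /= => HX HM; arr.
have := tA_slide (Arrow (hb X Y)) (Arrow (hb M W)).
rewrite /= -!tA_id !tAA => S.
rewrite HX HM !tA_cAl; [|dc..].
rewrite !tA_cAr; [|dc..].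
rewrite !tAA.
rewrite -[LHS]cA_assoc; [|dc..].
rewrite -[RHS]cA_assoc; [|dc..].
congr (cA _ _).
rewrite [LHS]cA_assoc; [|dc..].
by rewrite S -[LHS]cA_assoc; [|dc..].
Qed.

Definition act (X : Z) (M : A) : A :=
  CentreOb (act_hb_iso X M) (act_hb_nat X M) (fun Y W => act_hb_tens _).

Lemma actm_hb (X X' : Z) (M M' : A) (f : hom X X') (g : hom M M') (Y : C) :
  act_hb X' M' Y ∘ ((chom f ⊠ chom g) ⊠ idm (G Y)) =
  (idm Y ⊠ (chom f ⊠ chom g)) ∘ act_hb X M Y.
Proof.
have Hf := congr1 (@Arrow C _ _) (chom_hb f Y).
have Hg := congr1 (@Arrow C _ _) (chom_hb g Y).
move: Hf Hg; arr; rewrite /= => Hf Hg; apply: arrow_inj; arr.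
rewrite -!tAA -[LHS]cA_assoc; [|dc..].
rewrite -[in LHS]tA_cA // Hg cA1a // -{1}(cAa1 (a := Arrow (chom f)) erefl).
rewrite tA_cA // [LHS]cA_assoc; [|dc..].
rewrite [tA (Arrow (chom f)) _]tAA -[in LHS]tA_cA // Hf cA1a //.
rewrite [in RHS]tAA [RHS]cA_assoc; [|dc..].
by rewrite -[in RHS]tA_cA // cAa1.
Qed.

Definition actm (X X' : Z) (M M' : A) (f : hom X X') (g : hom M M') :
    hom (act X M) (act X' M') :=
  @CentreHom C G (act X M) (act X' M') _ (actm_hb f g).

Lemma actm_id (X : Z) (M : A) : actm (idm X) (idm M) = idm (act X M).
Proof. by apply: centre_hom_inj; apply: tensm_id. Qed.

Lemma actm_cmp (X X' X'' : Z) (M M' M'' : A) (f' : hom X' X'') (f : hom X X')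
    (g' : hom M' M'') (g : hom M M') :
  actm (f' ∘ f) (g' ∘ g) = actm f' g' ∘ actm f g.
Proof. by apply: centre_hom_inj; apply: tensm_cmp. Qed.

End Action.

Definition centre_unit_hb (Y : C) : hom (𝟙 ⊗ idSF C Y) (Y ⊗ 𝟙) :=
  ⟦ idm Y ⟧.

Lemma centre_unit_hb_iso (Y : C) : is_iso (centre_unit_hb Y).
Proof. by apply: is_iso_hcast; apply: is_iso_id. Qed.

Lemma centre_unit_hb_nat (Y Y' : C) (f : hom Y Y') :
  centre_unit_hb Y' ∘ (idm 𝟙 ⊠ fmap (idSF C) f) =
  (f ⊠ idm 𝟙) ∘ centre_unit_hb Y.
Proof. by apply: arrow_inj; arr; rewrite /= tA1a tAa1 cA1a // cAa1. Qed.

Lemma centre_unit_hb_tens (Y W : C) e :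
  centre_unit_hb (Y ⊗ W) ≡
  cmpE (idm Y ⊠ centre_unit_hb W) (centre_unit_hb Y ⊠ idm (idSF C W)) e.
Proof. by arr; rewrite /= tA_id cA1a. Qed.

Definition centre_unit : Z :=
  CentreOb centre_unit_hb_iso centre_unit_hb_nat
    (fun Y W => centre_unit_hb_tens _).

Section Strictness.
Variable G : smfunctor C C.
Local Notation A := (centre G).

Lemma actA (X Y : Z) (M : A) : act X (act Y M) = act (act X Y) M.
Proof.
apply: centre_ob_inj => [|V] /=; first exact: tensA.
arr; rewrite tA_cAl; [|dc..].
rewrite tA_cAr; [|dc..].
rewrite -!tA_id !tAA /=.
by rewrite cA_assoc; [|dc..].
Qed.

Lemma act1 (M : A) : act centre_unit M = M.
Proof.
apply: centre_ob_inj => [|V] /=; first exact: tens1o.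
by arr; rewrite tA_id tA1a cA1a.
Qed.

Lemma actmA (X X' Y Y' : Z) (M M' : A) (f : hom X X') (g : hom Y Y')
    (h : hom M M') :
  actm f (actm g h) ≡ actm (actm f g) h.
Proof. by apply: centre_arrow; [apply: actA|apply: actA|apply: tensmA]. Qed.

Lemma actm1 (M M' : A) (f : hom M M') : actm (idm centre_unit) f ≡ f.
Proof. by apply: centre_arrow; [apply: act1|apply: act1|apply: tensm1f]. Qed.

End Strictness.

Lemma act_unit (X : Z) : act X centre_unit = X.
Proof.
apply: centre_ob_inj => [|V] /=; first exact: tenso1.
by arr; rewrite tA_id tAa1 cAa1.
Qed.

Lemma actm_unit (X X' : Z) (f : hom X X') : actm f (idm centre_unit) ≡ f.
Proof. by apply: centre_arrow; [apply: act_unit|apply: act_unit|apply: tensmf1]. Qed.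

End CentreAction.

Definition drinfeld (C : smcat) : smcat :=
  @SMCat (centre (idSF C)) (@act C (idSF C)) (@centre_unit C)
    (@actm C (idSF C)) (@actm_id C (idSF C)) (@actm_cmp C (idSF C))
    (@actA C (idSF C)) (@act1 C (idSF C)) (@act_unit C)
    (@actmA C (idSF C)) (@actm1 C (idSF C)) (@actm_unit C).

Record lmodcat (Z : smcat) := LModCat {
  lmodcat_cat :> category;
  lact : Z -> lmodcat_cat -> lmodcat_cat;
  lactm : forall (X X' : Z) (M M' : lmodcat_cat),
    hom X X' -> hom M M' -> hom (lact X M) (lact X' M');
  lactm_id : forall X M, lactm (idm X) (idm M) = idm (lact X M);
  lactm_cmp : forall (X X' X'' : Z) (M M' M'' : lmodcat_cat)
      (f' : hom X' X'') (f : hom X X') (g' : hom M' M'') (g : hom M M'),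
    lactm (f' ∘ f) (g' ∘ g) = lactm f' g' ∘ lactm f g;
  lactA : forall X Y M, lact X (lact Y M) = lact (X ⊗ Y) M;
  lact1 : forall M, lact 𝟙 M = M;
  lactmA : forall (X X' Y Y' : Z) (M M' : lmodcat_cat)
      (f : hom X X') (g : hom Y Y') (h : hom M M'),
    lactm f (lactm g h) ≡ lactm (f ⊠ g) h;
  lactm1 : forall (M M' : lmodcat_cat) (f : hom M M'),
    lactm (idm 𝟙) f ≡ f }.

Arguments lact {Z l} _ _.
Arguments lactm {Z l X X' M M'} _ _.

Notation "X ▷ M" := (lact X M) (at level 38, left associativity) : cat_scope.
Notation "f ▶ g" := (lactm f g) (at level 38, left associativity) : cat_scope.

Definition regular (Z : smcat) : lmodcat Z :=
  @LModCat Z Z (@tens Z) (@tensm Z) (@tensm_id Z) (@tensm_cmp Z)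
    (@tensA Z) (@tens1o Z) (@tensmA Z) (@tensm1f Z).

Definition antidrinfeld (C : strict_rigidcat) : lmodcat (drinfeld C) :=
  @LModCat (drinfeld C) (centre (bidualSF C)) (@act C (bidualSF C))
    (@actm C (bidualSF C)) (@actm_id C (bidualSF C)) (@actm_cmp C (bidualSF C))
    (@actA C (bidualSF C)) (@act1 C (bidualSF C))
    (@actmA C (bidualSF C)) (@actm1 C (bidualSF C)).

Record lmod_functor (Z : smcat) (M N : lmodcat Z) := LModFunctor {
  lmod_functor_functor :> functor M N;
  delta : forall (X : Z) (A : M),
    hom (lmod_functor_functor (X ▷ A)) (X ▷ lmod_functor_functor A);
  delta_iso : forall X A, is_iso (delta X A);
  delta_nat : forall (X X' : Z) (A A' : M) (f : hom X X') (g : hom A A'),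
    delta X' A' ∘ fmap lmod_functor_functor (f ▶ g) =
    (f ▶ fmap lmod_functor_functor g) ∘ delta X A;
  deltaM : forall (X Y : Z) (A : M),
    delta (X ⊗ Y) A ≡ (idm X ▶ delta Y A) ∘ delta X (Y ▷ A);
  delta1 : forall A : M, delta 𝟙 A ≡ idm (lmod_functor_functor A) }.

Record lmod_equivalence (Z : smcat) (M N : lmodcat Z) := LModEquivalence {
  lmod_equivalence_functor :> lmod_functor M N;
  lmod_equivalenceP : is_equivalence lmod_equivalence_functor }.

Definition is_equiv_rel (T : Type) (R : T -> T -> Prop) : Prop :=
  [/\ forall x, R x x, forall x y, R x y -> R y x
    & forall x y z, R x y -> R y z -> R x z].

(* The set of equivalence classes of [R]; see [quasi_pivotal_equivP],
   [isomorphicP] and [nat_isoP] for the relations used below. *)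
Definition quotient (T : Type) (R : T -> T -> Prop) : Type :=
  {c : T -> Prop | exists x, c = R x}.

Definition invertible (C : rigidcat) (X : C) : Prop :=
  is_iso (evl X) /\ is_iso (coevl X).

(* [qrho] is a monoidal natural isomorphism from the identity functor to
   [β ⊗ (-)^∨^∨ ⊗ β^∨]; the monoidal structure of the latter is
   [β ⊗ X^∨^∨ ⊗ evl β ⊗ Y^∨^∨ ⊗ β^∨] on tensor products and [coevl β] on the
   unit. *)
Record quasi_pivotal (C : strict_rigidcat) := QuasiPivotal {
  qbeta : C;
  qbeta_invertible : invertible qbeta;
  qrho : forall X : C, hom X (qbeta ⊗ X^∨^∨ ⊗ qbeta^∨);
  qrho_iso : forall X, is_iso (qrho X);
  qrho_nat : forall (X Y : C) (f : hom X Y),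
    qrho Y ∘ f = (idm qbeta ⊠ fmap (bidualF C) f ⊠ idm qbeta^∨) ∘ qrho X;
  qrho_tens : forall X Y : C,
    qrho (X ⊗ Y) ≡
    (idm qbeta ⊠ idm X^∨^∨ ⊠ evl qbeta ⊠ idm Y^∨^∨ ⊠ idm qbeta^∨)
      ⊚ (qrho X ⊠ qrho Y);
  qrho_unit : qrho 𝟙 ≡ coevl qbeta }.

Definition quasi_pivotal_equiv (C : strict_rigidcat) (P P' : quasi_pivotal C) :=
  exists (psi : hom (qbeta P') (qbeta P)) (psiV : hom (qbeta P) (qbeta P')),
    inverses psi psiV /\
    forall X : C, qrho P' X = (psiV ⊠ idm X^∨^∨ ⊠ ldualm psi) ∘ qrho P X.

Lemma quasi_pivotal_equivP (C : strict_rigidcat) :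
  is_equiv_rel (@quasi_pivotal_equiv C).
Proof.
split=> [P|P Q [f [g [[gf fg] H]]]|P Q R [f [g [[gf fg] H]]] [h [k [[kh hk] K]]]].
- exists (idm _), (idm _); split; first by split; rewrite cmp1m.
  by move=> X; rewrite ldualm_id !tensm_id cmp1m.
- exists g, f; split=> // X; rewrite H cmpA -!tensm_cmp fg cmp1m.
  by rewrite -ldualm_cmp fg ldualm_id !tensm_id cmp1m.
- exists (f ∘ h), (k ∘ g); split.
    split; first by rewrite cmpA -[k ∘ g ∘ f]cmpA gf cmpm1.
    by rewrite cmpA -[f ∘ h ∘ k]cmpA hk cmpm1.
  by move=> X; rewrite K H cmpA -!tensm_cmp cmp1m ldualm_cmp.
Qed.

Definition QPiv (C : strict_rigidcat) : Type :=
  quotient (@quasi_pivotal_equiv C).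

Definition isomorphic (C : category) (X Y : C) : Prop :=
  exists f : hom X Y, is_iso f.

Lemma isomorphicP (C : category) : is_equiv_rel (@isomorphic C).
Proof.
split=> [X|X Y [f [g [gf fg]]]|X Y Z [f If] [g Ig]].
- by exists (idm X); apply: is_iso_id.
- by exists g, f.
- by exists (g ∘ f); apply: is_iso_cmp.
Qed.

Definition Pic (C : strict_rigidcat) : Type :=
  quotient (fun A B : {A : centre (bidualSF C) | invertible (cob A)} =>
    isomorphic (sval A) (sval B)).

Lemma nat_isoP (C D : category) : is_equiv_rel (@nat_iso C D).
Proof.
split=> [F|F G [t [tN tI]]|F G H [t [tN tI]] [u [uN uI]]].
- exists (fun X => idm (F X)); split=> [X Y f|X]; last exact: is_iso_id.
  by rewrite cmp1m cmpm1.
- have [v vP] : exists v, forall X : C, inverses (t X) (v X).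
    by exists (fun X => sval (cid (tI X))) => X; case: cid.
  exists v; split=> [X Y f|X]; last by exists (t X); case: (vP X).
  have [vtX tvX] := vP X; have [vtY tvY] := vP Y.
  by rewrite -[LHS]cmpm1 -tvX cmpA -[_ ∘ t X]cmpA -tN cmpA vtY cmp1m.
- exists (fun X => u X ∘ t X); split=> [X Y f|X]; last exact: is_iso_cmp.
  by rewrite -cmpA tN cmpA uN cmpA.
Qed.

Definition ModEquiv (C : strict_rigidcat) : Type :=
  quotient
    (fun F G : lmod_equivalence (regular (drinfeld C)) (antidrinfeld C) =>
      nat_iso F G).

(* Main.v *)
(* Transposing [ρ_X : X -> β ⊗ X^∨^∨ ⊗ β^∨] along the invertible duality of [β]
   yields [X ⊗ β -> β ⊗ X^∨^∨], and the axioms of a quasi-pivotal structure say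
   that the inverses of these maps form a half-braiding on [β].

   An object [A] of the anti-centre gives the module functor [- ⊗ A], and every
   module functor [F] out of the centre is isomorphic to [- ⊗ F 1].  Let
   [a] be the object underlying [A].  For all [M] the object [M ⊗ a^∨] lies in
   the Drinfeld centre, and [M |-> M ⊗ a^∨] is right adjoint to [- ⊗ A] with unit
   [coev] and counit [ev]; so [- ⊗ A] is an equivalence when [a] is invertible.
   Conversely, if [- ⊗ A] is an equivalence then [coev : 1 -> a ⊗ a^∨] is
   invertible, and the half-braiding at the right dual [b] of [a] gives
   [a ⊗ a^∨ = a ⊗ b^∨^∨ ≅ b ⊗ a], whence [a] is invertible. *)
Require Import Defs.
From mathcomp Require Import all_boot.
From mathcomp Require Import boolp.

Set Implicit Arguments.
Unset Strict Implicit.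
Unset Printing Implicit Defensive.
Local Open Scope cat_scope.

(** * Bijections between quotients *)

Section Quotient.
Variables (T : Type) (R : T -> T -> Prop).
Hypothesis RP : is_equiv_rel R.

Lemma class_eq (x y : T) : R x = R y <-> R x y.
Proof.
have [Rr Rs Rt] := RP; split=> [->|Rxy]; first exact: Rr.
apply/funext => z; apply/propext; split; first exact/Rt/Rs.
exact: Rt.
Qed.

Lemma quotient_inj (c d : quotient R) : sval c = sval d -> c = d.
Proof. by case: c d => [c Hc] [d Hd] /= E; apply: eq_exist. Qed.

Definition qclass (x : T) : quotient R := exist _ (R x) (ex_intro _ x erefl).

Definition qrepr (c : quotient R) : T := sval (cid (svalP c)).

Lemma qreprK (c : quotient R) : qclass (qrepr c) = c.
Proof. by apply: quotient_inj => /=; rewrite /qrepr; case: cid => x /= ->. Qed.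

Lemma qclass_eq (x y : T) : qclass x = qclass y <-> R x y.
Proof.
rewrite -class_eq; split=> [/(congr1 sval)//|E].
exact: quotient_inj.
Qed.

End Quotient.

(** The inverse sends a class to the class of a chosen preimage. The two-sided compatibility of [h]
    makes both composites independent of the representatives and of this choice. *)
Lemma quotient_bij (T U : Type) (R : T -> T -> Prop) (S : U -> U -> Prop)
    (h : T -> U) :
  is_equiv_rel R -> is_equiv_rel S ->
  (forall x y, R x y <-> S (h x) (h y)) ->
  (forall u, exists x, S (h x) u) ->
  exists f : quotient R -> quotient S, bijective f.
Proof.
move=> RP SP hRS /choice[k hk].
exists (fun c => qclass S (h (qrepr c))), (fun d => qclass R (k (qrepr d))).
  move=> c; rewrite -[RHS]qreprK; apply/(qclass_eq RP)/hRS.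
  have [_ Ss St] := SP; apply: St (hk _) _.
  by apply/(qclass_eq SP); rewrite qreprK.
move=> d; rewrite -[RHS]qreprK; apply/(qclass_eq SP).
have [_ Ss St] := SP; apply: St (hk _).
by apply/hRS/(qclass_eq RP); rewrite qreprK.
Qed.

(** * Equivalences and module functors *)

Definition faithful (C D : category) (F : functor C D) :=
  forall (X Y : C) (f g : hom X Y), fmap F f = fmap F g -> f = g.

Definition full (C D : category) (F : functor C D) :=
  forall (X Y : C) (g : hom (F X) (F Y)), exists f : hom X Y, fmap F f = g.

Lemma iso_epi (C : category) (X Y Z : C) (e : hom X Y) (f g : hom Y Z) :
  is_iso e -> f ∘ e = g ∘ e -> f = g.
Proof.
by move=> [e' [_ ee']] E; rewrite -[f]cmpm1 -[g]cmpm1 -ee' !cmpA E.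
Qed.

Lemma iso_mono (C : category) (X Y Z : C) (e : hom Y Z) (f g : hom X Y) :
  is_iso e -> e ∘ f = e ∘ g -> f = g.
Proof.
by move=> [e' [e'e _]] E; rewrite -[f]cmp1m -[g]cmp1m -e'e -!cmpA E.
Qed.

Lemma is_iso_inverse (C : category) (X Y : C) (f : hom X Y) (g : hom Y X) :
  inverses f g -> is_iso g.
Proof. by move=> [gf fg]; exists f. Qed.

Lemma nat_iso_faithful (C D : category) (F G : functor C D) :
  nat_iso F G -> faithful G -> faithful F.
Proof.
move=> [t [tN tI]] Gf X Y f g E; apply: Gf; apply: (iso_epi (tI X)).
by rewrite -!tN E.
Qed.

Lemma nat_iso_full (C D : category) (F G : functor C D) :
  nat_iso F G -> full G -> full F.
Proof.
move=> [t [tN tI]] Gf X Y g.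
have [tX' [tX'K tXK]] := tI X.
have [f fE] := Gf X Y (t Y ∘ g ∘ tX').
by exists f; apply: (iso_mono (tI Y)); rewrite tN fE -!cmpA tX'K cmpm1.
Qed.

Lemma equivalence_faithful (C D : category) (F : functor C D) :
  is_equivalence F -> faithful F.
Proof.
move=> [G [GF _]] X Y f g E.
by apply: (nat_iso_faithful GF) => //=; rewrite E.
Qed.

(** Fullness of [G ∘ F ≅ id] yields [f] with [G (F f) = G g], and [G], an equivalence with inverse
    [F], is faithful. *)
Lemma equivalence_full (C D : category) (F : functor C D) :
  is_equivalence F -> full F.
Proof.
move=> [G [GF FG]] X Y g.
have [|f fE] := nat_iso_full GF _ (fmap G g : hom (compF G F X) (compF G F Y)).
  by move=> U V h; exists h.
by exists f; apply: (@equivalence_faithful _ _ G) => //; exists F.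
Qed.

(** * Module functors given by acting on a fixed object *)

Section RightMultiplication.
Variables (Z : smcat) (N : lmodcat Z) (A : N).

Definition rmulF : functor Z N :=
  @Functor Z N (fun X => X ▷ A) (fun X Y f => f ▶ idm A)
    (fun X => lactm_id X A)
    (fun X Y V g f => etrans (congr1 (lactm _) (esym (cmp1m _)))
       (lactm_cmp g f (idm A) (idm A))).

Definition rmul_delta (X Y : Z) : hom ((X ⊗ Y) ▷ A) (X ▷ (Y ▷ A)) :=
  hcast (idm _) erefl (esym (lactA X Y A)).

Lemma rmul_delta_iso (X Y : Z) : is_iso (rmul_delta X Y).
Proof. exact/is_iso_hcast/is_iso_id. Qed.

Lemma rmul_delta_nat (X X' Y Y' : Z) (f : hom X X') (g : hom Y Y') :
  rmul_delta X' Y' ∘ ((f ⊠ g) ▶ idm A) = (f ▶ (g ▶ idm A)) ∘ rmul_delta X Y.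
Proof.
apply: arrow_inj; arr; rewrite cA1a // lactmA cAa1 //.
Qed.

Definition lA (a : arrow Z) (b : arrow N) : arrow N := Arrow (amor a ▶ amor b).

Lemma lA_id (X : Z) (M : N) : lA (iA X) (iA M) = iA (X ▷ M).
Proof. by rewrite /lA lactm_id. Qed.

Lemma arrow_lact (X X' : Z) (M M' : N) (f : hom X X') (g : hom M M') :
  Arrow (f ▶ g) = lA (Arrow f) (Arrow g).
Proof. by []. Qed.

Lemma rmul_deltaM (X Y V : Z) :
  rmul_delta (X ⊗ Y) V ≡ (idm X ▶ rmul_delta Y V) ∘ rmul_delta X (Y ⊗ V).
Proof.
by arr; rewrite arrow_lact; arr; rewrite lA_id cA1a ?lactA /= ?tensA.
Qed.

Lemma rmul_delta1 (X : Z) : rmul_delta 𝟙 X ≡ idm (X ▷ A).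
Proof. by arr; rewrite tens1o. Qed.

Definition rmulL : lmod_functor (regular Z) N :=
  @LModFunctor Z (regular Z) N rmulF rmul_delta rmul_delta_iso
    rmul_delta_nat rmul_deltaM rmul_delta1.

End RightMultiplication.

(** The isomorphism is [delta F X 𝟙], read along [X ⊗ 𝟙 = X]. Its naturality at [f] is [delta_nat]
    at the pair of [f] and [idm 𝟙]. *)
Lemma lmod_functor_rmul (Z : smcat) (N : lmodcat Z)
    (F : lmod_functor (regular Z) N) :
  nat_iso F (rmulF (F 𝟙)).
Proof.
have FE X Y (f : hom X Y) (X' Y' : Z) (f' : hom X' Y') :
    f ≡ f' -> fmap F f ≡ fmap F f'.
  exact: (congr1 (fun a : arrow Z => Arrow (@fmap _ _ F _ _ (amor a)))).
exists (fun X => hcast (delta F X (𝟙 : Z)) (congr1 F (tenso1 X)) erefl).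
split=> [X Y f|X]; last exact/is_iso_hcast/delta_iso.
apply: arrow_inj; arr.
rewrite -(FE _ _ _ _ _ _ (tensmf1 f)) -arrow_cmp.
rewrite (delta_nat F (A' := (𝟙 : Z)) (A := (𝟙 : Z)) f (idm 𝟙)).
by rewrite fmap_id; arr.
Qed.

(** The component at [𝟙] of a natural isomorphism compares [𝟙 ▷ A = A] with [𝟙 ▷ B = B]; conversely
    [f] acts through [idm X ▶ f]. *)
Lemma rmul_isomorphic (Z : smcat) (N : lmodcat Z) (A B : N) :
  nat_iso (rmulF A) (rmulF B) <-> isomorphic A B.
Proof.
split=> [[t [_ tI]]|[f fI]].
  exists (hcast (t 𝟙) (lact1 A) (lact1 B)); exact/is_iso_hcast/tI.
exists (fun X => idm X ▶ f); split=> [X Y g|X] /=.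
  by rewrite -!lactm_cmp !cmp1m !cmpm1.
have [h [hf fh]] := fI.
by exists (idm X ▶ h); split; rewrite -lactm_cmp cmp1m ?hf ?fh lactm_id.
Qed.

Local Notation "a ∙ b" := (cA a b) (at level 40, left associativity) : cat_scope.
Local Notation "a ⋆ b" := (tA a b) (at level 38, left associativity) : cat_scope.

(** * Half-braidings and transposes *)

Lemma inverses_uniq (C : category) (X Y : C) (f : hom X Y) (g h : hom Y X) :
  inverses f g -> inverses f h -> g = h.
Proof. by move=> [gf _] [_ fh]; rewrite -[g]cmpm1 -fh cmpA gf cmp1m. Qed.

Lemma sm_tens (C D : smcat) (G : smfunctor C D) (X Y : C) :
  G (X ⊗ Y) = G X ⊗ G Y.
Proof. by have [] := smfunctor_strict G. Qed.

Lemma sm_unit (C D : smcat) (G : smfunctor C D) : G 𝟙 = 𝟙.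
Proof. by have [] := smfunctor_strict G. Qed.

Ltac dg := solve [dc; rewrite ?(sm_tens, sm_unit) ?(tensA, tens1o, tenso1) //].

Section InverseBraiding.
Variables (C : smcat) (G : smfunctor C C) (A : C).
Variable s : forall Y : C, hom (Y ⊗ A) (A ⊗ G Y).
Hypothesis s_iso : forall Y, is_iso (s Y).
Hypothesis s_nat : forall (Y Y' : C) (f : hom Y Y'),
  (idm A ⊠ fmap G f) ∘ s Y = s Y' ∘ (f ⊠ idm A).
Hypothesis s_tens : forall Y W : C,
  s (Y ⊗ W) ≡ (s Y ⊠ idm (G W)) ⊚ (idm Y ⊠ s W).

Definition inv_braiding (Y : C) : hom (A ⊗ G Y) (Y ⊗ A) := sval (cid (s_iso Y)).

Lemma inv_braidingP (Y : C) : inverses (s Y) (inv_braiding Y).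
Proof. by rewrite /inv_braiding; case: cid. Qed.

Lemma inv_braiding_iso (Y : C) : is_iso (inv_braiding Y).
Proof. exact: is_iso_inverse (inv_braidingP Y). Qed.

Lemma inv_braiding_nat (Y Y' : C) (f : hom Y Y') :
  inv_braiding Y' ∘ (idm A ⊠ fmap G f) = (f ⊠ idm A) ∘ inv_braiding Y.
Proof.
apply: (iso_epi (s_iso Y)); rewrite -!cmpA s_nat.
have [-> _] := inv_braidingP Y; have [H _] := inv_braidingP Y'.
by rewrite cmpA H cmpm1 cmp1m.
Qed.

Lemma inv_braiding_tens (Y W : C) :
  inv_braiding (Y ⊗ W) ≡ (idm Y ⊠ inv_braiding W) ⊚ (inv_braiding Y ⊠ idm (G W)).
Proof.
have := s_tens Y W.
have [/(congr1 Arrow) + _] := inv_braidingP (Y ⊗ W).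
have [_ /(congr1 Arrow)] := inv_braidingP Y.
have [_ /(congr1 Arrow)] := inv_braidingP W.
arr => W1 Y1 E S; rewrite S in E.
rewrite -[RHS](cA1a (X := Y ⊗ W ⊗ A)); [|dg..].
rewrite -E -!cA_assoc; [|dg..].
rewrite [(iA Y ⋆ _) ∙ _]cA_assoc; [|dg..].
rewrite -tA_cAr // W1 tA_id cA1a; [|dg..].
by rewrite -tA_cAl // Y1 tA_id cAa1; [|dg..].
Qed.

(** Transposing a quasi-pivotal structure gives maps [Y ⊗ A -> A ⊗ G Y], opposite to a
    half-braiding; this packages their inverses. *)
Definition inverse_centre_ob : centre G :=
  CentreOb inv_braiding_iso inv_braiding_nat inv_braiding_tens.

End InverseBraiding.

(* In a rigid category a lax half-braiding is automatically invertible. *)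
Section RigidBraiding.
Variables (C : rigidcat) (D : C) (l : forall Y : C, hom (D ⊗ Y) (Y ⊗ D)).
Hypothesis l_nat : forall (Y Y' : C) (f : hom Y Y'),
  l Y' ∘ (idm D ⊠ f) = (f ⊠ idm D) ∘ l Y.
Hypothesis l_tens : forall Y W : C,
  l (Y ⊗ W) ≡ (idm Y ⊠ l W) ⊚ (l Y ⊠ idm W).
Hypothesis l_unit : l 𝟙 ≡ idm D.

(** The mate of [l (rdual Y)], bent around with [coevr Y] and [evr Y]. *)
Definition rbraid_inv (Y : C) : hom (Y ⊗ D) (D ⊗ Y) :=
  ⟦ (evr Y ⊠ idm (D ⊗ Y)) ⊚ (idm Y ⊠ l (rdual Y) ⊠ idm Y)
    ⊚ (idm (Y ⊗ D) ⊠ coevr Y) ⟧.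

(** The tensor axiom merges [l Y] and [l (rdual Y)] into one component. Naturality along [evr Y] or
    [coevr Y] reduces it to [l 𝟙], the identity, and a snake identity remains. *)
Lemma rbraid_inverses (Y : C) : inverses (l Y) (rbraid_inv Y).
Proof.
have S1 := snaker1 Y; move: S1; arr => S1.
have L1 := l_unit; rewrite -/(iA D) in L1.
split; apply: arrow_inj; arr.
- have T := l_tens Y (rdual Y); move: T; arr => T.
  have /(congr1 Arrow) := l_nat (evr Y); arr; rewrite L1 => E.
  have SL := tA_slide (Arrow (l Y)) (Arrow (coevr Y)).
  rewrite /= tAa1 in SL.
  rewrite -!cA_assoc; [|dg..].
  rewrite -SL -[iA (rdual Y ⊗ Y)]tA_id tAA.
  rewrite [(iA Y ⋆ _ ⋆ _) ∙ _]cA_assoc; [|dg..].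
  rewrite -tA_cAl -?T -?tA_id ?tAA; [|dg..].
  rewrite cA_assoc; [|dg..].
  rewrite -tA_cAl -?E; [|dg..].
  rewrite cA1a; [|dg..].
  by rewrite -!tAA -tA_cAr ?S1 ?tA_id; [|dg..].
- have T := l_tens (rdual Y) Y; move: T; arr => T.
  have /(congr1 Arrow) := l_nat (coevr Y); arr; rewrite L1 => E.
  have SL := tA_slide (Arrow (evr Y)) (Arrow (l Y)).
  rewrite /= tA1a in SL.
  rewrite ![Arrow (l Y) ∙ _]cA_assoc; [|dg..].
  rewrite -SL -[iA (Y ⊗ rdual Y)]tA_id -!tAA.
  rewrite -!cA_assoc; [|dg..].
  rewrite [(iA Y ⋆ (iA _ ⋆ _)) ∙ _]cA_assoc; [|dg..].
  rewrite -tA_cAr -?T; [|dg..].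
  rewrite -[iA (Y ⊗ D)]tA_id -[iA Y ⋆ iA D ⋆ _]tAA -tA_cAr ?E; [|dg..].
  rewrite cAa1; [|dg..].
  by rewrite !tAA -tA_cAl ?S1; [|dg..].
Qed.

Lemma rigid_braiding_iso (Y : C) : is_iso (l Y).
Proof. by exists (rbraid_inv Y); apply: rbraid_inverses. Qed.

End RigidBraiding.

Section Transpose.
Variables (C : rigidcat) (A : C).
Local Notation e := (Arrow (evl A)).
Local Notation c := (Arrow (coevl A)).

(** Tensoring the transpose with [A^∨] and precomposing with [coevl A] recovers the arrow, by the
    snake identity on [A^∨]. *)
Lemma transpose_inj (Q : C) (f g : arrow C) :
  cod f = Q ⊗ A^∨ -> cod g = Q ⊗ A^∨ -> dom f = dom g ->
  iA Q ⋆ e ∙ f ⋆ iA A = iA Q ⋆ e ∙ g ⋆ iA A -> f = g.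
Proof.
have S2 := snakel2 A; move: S2; arr => S2.
suff K (h : arrow C) : cod h = Q ⊗ A^∨ ->
    h = (iA Q ⋆ e ∙ h ⋆ iA A) ⋆ iA A^∨ ∙ iA (dom h) ⋆ c.
  by move=> /K Kf /K Kg D E; rewrite Kf E D -Kg.
case: h => P R h /= hR; subst R.
have SL := tA_slide (Arrow h) c; rewrite /= tAa1 -!tA_id tAA in SL.
rewrite tA_cAl -?cA_assoc ?SL; [|dg..].
rewrite cA_assoc -!tAA -?tA_cAr ?S2 ?tA_id ?cA1a; [|dg..].
by [].
Qed.

End Transpose.

(** * The inverse half-braiding of an object of a centre *)

Section CentreInverse.
Variables (C : smcat) (G : smfunctor C C) (A : centre G).

(* Chosen by [cid], so that it does not unfold when rewriting with arrows. *)
Definition hb_inv (Y : C) : hom (Y ⊗ cob A) (cob A ⊗ G Y) :=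
  sval (cid (hb_iso A Y)).

Lemma hb_invP (Y : C) : inverses (hb A Y) (hb_inv Y).
Proof. by rewrite /hb_inv; case: cid. Qed.

Lemma hb_invK (Y : C) : Arrow (hb_inv Y) ∙ Arrow (hb A Y) = iA (cob A ⊗ G Y).
Proof. by have [/(congr1 Arrow)] := hb_invP Y; arr. Qed.

Lemma hbK (Y : C) : Arrow (hb A Y) ∙ Arrow (hb_inv Y) = iA (Y ⊗ cob A).
Proof. by have [_ /(congr1 Arrow)] := hb_invP Y; arr. Qed.

Lemma hb_inv_nat (Y Y' : C) (f : hom Y Y') :
  (idm (cob A) ⊠ fmap G f) ∘ hb_inv Y = hb_inv Y' ∘ (f ⊠ idm (cob A)).
Proof.
have [_ K] := hb_invP Y; have [K' _] := hb_invP Y'.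
by rewrite -[RHS]cmpm1 -{1}K !cmpA -[_ ∘ _ ∘ hb A Y]cmpA -hb_nat cmpA K' cmp1m.
Qed.

Lemma hb_inv_tens (Y W : C) :
  hb_inv (Y ⊗ W) ≡ (hb_inv Y ⊠ idm (G W)) ⊚ (idm Y ⊠ hb_inv W).
Proof.
have T := hb_tens A Y W; have E := hb_invK (Y ⊗ W).
move: T; arr => T.
rewrite -[RHS](cA1a (X := cob A ⊗ G (Y ⊗ W))); [|dg..].
rewrite -E T -!cA_assoc; [|dg..].
rewrite [Arrow (hb A Y) ⋆ _ ∙ _]cA_assoc; [|dg..].
rewrite -tA_cAl ?hbK ?tA_id ?cA1a; [|dg..].
by rewrite -tA_cAr ?hbK ?tA_id ?cAa1; [|dg..].
Qed.

(** The tensor axiom at [𝟙 ⊗ 𝟙] makes this component idempotent, and an invertible idempotent is an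
    identity. *)
Lemma hb_unit : hb A 𝟙 ≡ idm (cob A).
Proof.
have G1 : iA (G 𝟙) = iA 𝟙 :> arrow C by rewrite sm_unit.
have T := hb_tens A 𝟙 𝟙; have E := hb_invK 𝟙; move: T; arr.
rewrite tA1a G1 tAa1 (congr1 (fun X => Arrow (hb A X)) (tens1o 𝟙)) => T.
rewrite -[LHS](cA1a (X := cob A)); [|dg..].
have <- : iA (cob A ⊗ G 𝟙) = iA (cob A) by rewrite sm_unit tenso1.
by rewrite -E -cA_assoc -?T ?E; [|dg..].
Qed.

Lemma hb_inv_unit : hb_inv 𝟙 ≡ idm (cob A).
Proof.
have := hb_invK 𝟙; rewrite hb_unit cAa1 -/(iA _); last by dg.
by move=> ->; rewrite sm_unit tenso1.
Qed.

End CentreInverse.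

(** * The mate of a half-braiding on the dual object *)

Section InnerHom.
Variables (C : rigidcat) (G : smfunctor C C) (A : centre G).
Local Notation a := (cob A).
Local Notation e := (Arrow (evl a)).
Local Notation c := (Arrow (coevl a)).

(* The inverse half-braiding [Y ⊗ a -> a ⊗ G Y] has a mate
   [a^∨ ⊗ Y -> G Y ⊗ a^∨], characterised by this equation. *)
Lemma dual_hb_exists (Y : C) : exists t : hom (a^∨ ⊗ Y) (G Y ⊗ a^∨),
  iA (G Y) ⋆ e ∙ Arrow t ⋆ iA a = e ⋆ iA (G Y) ∙ iA a^∨ ⋆ Arrow (hb_inv A Y).
Proof.
(* The usual mate: create [a ⊗ a^∨] on the right, move [Y] past [a], evaluate on the left. *)
exists ⟦ (evl a ⊠ idm (G Y ⊗ a^∨)) ⊚ (idm a^∨ ⊠ hb_inv A Y ⊠ idm a^∨)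
  ⊚ (idm (a^∨ ⊗ Y) ⊠ coevl a) ⟧.
arr.
have S1 := snakel1 a; move: S1; arr => S1.
rewrite !tA_cAl -?cA_assoc -?tAA ?tA_id; [|dg..].
rewrite [_ ⋆ e ∙ _]cA_assoc; [|dg..].
have := tA_slide e (iA (G Y) ⋆ e); rewrite /= tA1a tenso1 tensA => <-.
have := tA_slide (Arrow (hb_inv A Y)) e; rewrite /= tAa1 => SL.
rewrite -!cA_assoc; [|dg..].
congr (_ ∙ _).
rewrite -tA_id -[_ ⋆ (iA (G Y) ⋆ e)]tAA [iA a ⋆ (_ ⋆ _)]tAA !tA_id.
rewrite [(iA a^∨ ⋆ _) ∙ _]cA_assoc; [|dg..].
rewrite -tA_cAr -?SL; [|dg..].
rewrite -[iA (a^∨ ⊗ Y)]tA_id -[iA a^∨ ⋆ _ ⋆ _]tAA -tA_cAr; [|dg..].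
rewrite -cA_assoc; [|dg..].
by rewrite -[iA (Y ⊗ a)]tA_id -[iA Y ⋆ _ ⋆ _]tAA -tA_cAr ?S1 ?tA_id ?cAa1; [|dg..].
Qed.

(** Chosen by [cid] to hide the formula: by [transpose_inj] the equation [dual_hb_ev] determines it,
    and the arguments below use only that equation. *)
Definition dual_hb (Y : C) : hom (a^∨ ⊗ Y) (G Y ⊗ a^∨) :=
  sval (cid (dual_hb_exists Y)).

Lemma dual_hb_ev (Y : C) :
  iA (G Y) ⋆ e ∙ Arrow (dual_hb Y) ⋆ iA a =
  e ⋆ iA (G Y) ∙ iA a^∨ ⋆ Arrow (hb_inv A Y).
Proof. by rewrite /dual_hb; case: cid. Qed.

Lemma dual_hb_nat (Y Y' : C) (f : hom Y Y') :
  dual_hb Y' ∘ (idm a^∨ ⊠ f) = (fmap G f ⊠ idm a^∨) ∘ dual_hb Y.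
Proof.
have /(congr1 Arrow) := hb_inv_nat A f; arr => N.
apply/arrow_inj/(@transpose_inj _ a (G Y')) => //; arr.
have := tA_slide (Arrow (fmap G f)) e; rewrite /= tAa1 => SL.
have := tA_slide e (Arrow (fmap G f)); rewrite /= tA1a => SL'.
rewrite !tA_cAl ?cA_assoc ?dual_hb_ev; [|dg..].
rewrite -[in RHS]tAA tA_id -SL -[in RHS](cA_assoc (c := _ ⋆ iA a)) ?dual_hb_ev; [|dg..].
rewrite [RHS]cA_assoc -?SL'; [|dg..].
rewrite -!cA_assoc -?tA_id; [|dg..].
by rewrite -!tAA -!tA_cAr ?N; [|dg..].
Qed.

Lemma dual_hb_tens (Y W : C) :
  dual_hb (Y ⊗ W) ≡ (idm (G Y) ⊠ dual_hb W) ⊚ (dual_hb Y ⊠ idm W).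
Proof.
have T := hb_inv_tens A Y W; move: T; arr => T.
apply: (@transpose_inj _ a (G Y ⊗ G W)); [dg..|].
rewrite -sm_tens dual_hb_ev T sm_tens.
rewrite -tA_id.
have := tA_slide (Arrow (dual_hb Y)) (Arrow (hb_inv A W)); rewrite /= => SL.
rewrite tA_cAl -?tAA; [|dg..].
rewrite cA_assoc -?tA_cAr ?dual_hb_ev; [|dg..].
rewrite !tA_cAr -?cA_assoc ?tA_id; [|dg..].
rewrite [iA (G Y) ⋆ (iA _ ⋆ _)]tAA tA_id -SL.
rewrite [RHS]cA_assoc -?tA_id ?tAA -?tA_cAl ?dual_hb_ev; [|dg..].
by rewrite tA_cAl -?cA_assoc; [|dg..].
Qed.

Lemma dual_hb_unit : dual_hb 𝟙 ≡ idm a^∨.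
Proof.
apply: (@transpose_inj _ a 𝟙); [dg..|].
have G1 : iA (G 𝟙) = iA 𝟙 :> arrow C by rewrite sm_unit.
rewrite -{1}G1 dual_hb_ev hb_inv_unit G1.
by rewrite tA_id tAa1 tA1a !cAa1.
Qed.

Lemma coev_dual_hb (Y : C) :
  iA a ⋆ Arrow (dual_hb Y) ∙ c ⋆ iA Y = Arrow (hb_inv A Y) ⋆ iA a^∨ ∙ iA Y ⋆ c.
Proof.
have S1 := snakel1 a; move: S1; arr => S1.
apply: (@transpose_inj _ a (a ⊗ G Y)); [dg..|].
rewrite !tA_cAl; [|dg..].
have SL := tA_slide (Arrow (hb_inv A Y)) e; rewrite /= tAa1 in SL.
have SL' := tA_slide c (Arrow (hb_inv A Y)); rewrite /= tA1a in SL'.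
(* Both sides of the goal have transpose [hb_inv A Y]; this computes the right one. *)
have -> : iA (a ⊗ G Y) ⋆ e ∙
    (Arrow (hb_inv A Y) ⋆ iA a^∨ ⋆ iA a ∙ iA Y ⋆ c ⋆ iA a) = Arrow (hb_inv A Y).
  rewrite -[Arrow (hb_inv A Y) ⋆ _ ⋆ _]tAA tA_id cA_assoc -?SL -?cA_assoc; [|dg..].
  by rewrite -tA_id -!tAA -tA_cAr ?S1 ?tA_id ?cAa1; [|dg..].
rewrite cA_assoc -?tA_id -?tAA -?tA_cAr ?dual_hb_ev; [|dg..].
rewrite tA_cAr -?cA_assoc ?tA_id; [|dg..].
rewrite [iA a ⋆ (iA _ ⋆ _)]tAA tA_id -SL'.
by rewrite -tA_id !tAA cA_assoc -?tA_cAl ?S1 ?tA_id ?cA1a; [|dg..].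
Qed.

(** The half-braiding of [a ⊗ a^∨] is the composite of [hb A Y] and [dual_hb A Y], so this says that
    [coevl a] is a morphism of the Drinfeld centre. *)
Lemma hb_coev_dual_hb (Y : C) :
  Arrow (hb A Y) ⋆ iA a^∨ ∙ (iA a ⋆ Arrow (dual_hb Y) ∙ c ⋆ iA Y) = iA Y ⋆ c.
Proof.
rewrite coev_dual_hb cA_assoc -?tA_cAl ?hbK ?tA_id ?cA1a //; dg.
Qed.

End InnerHom.

(** * The right adjoint of [- ⊗ A] *)

Section InnerHomObject.
Variables (C : rigidcat) (G : smfunctor C C).
Local Notation Z := (centre (idSF C)).
Implicit Types (A M : centre G) (X : Z).

(** [dual_hb] introduces the twist [G] and the half-braiding of [M] removes it, so the result is an
    untwisted half-braiding. *)
Definition ihom_hb M A (Y : C) :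
    hom ((cob M ⊗ (cob A)^∨) ⊗ Y) (Y ⊗ (cob M ⊗ (cob A)^∨)) :=
  ⟦ (hb M Y ⊠ idm (cob A)^∨) ⊚ (idm (cob M) ⊠ dual_hb A Y) ⟧.

Lemma ihom_hb_nat M A (Y Y' : C) (f : hom Y Y') :
  ihom_hb M A Y' ∘ (idm (cob M ⊗ (cob A)^∨) ⊠ f) =
  (f ⊠ idm (cob M ⊗ (cob A)^∨)) ∘ ihom_hb M A Y.
Proof.
have /(congr1 Arrow) := hb_nat M f; have /(congr1 Arrow) := dual_hb_nat A f.
arr => HA HM; apply: arrow_inj; arr.
rewrite -!cA_assoc -?tA_id -?tAA -?tA_cAr ?HA; [|dg..].
rewrite tA_cAr -?cA_assoc; [|dg..].
rewrite cA_assoc ?[in RHS]cA_assoc ?tAA -?tA_cAl ?HM; [|dg..].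
by [].
Qed.

Lemma ihom_hb_tens M A (Y W : C) E :
  ihom_hb M A (Y ⊗ W) ≡
  cmpE (idm Y ⊠ ihom_hb M A W) (ihom_hb M A Y ⊠ idm W) E.
Proof.
have HM := hb_tens M Y W; have HA := dual_hb_tens A Y W.
move: HM HA; arr => HM HA; rewrite HM HA.
have SL := tA_slide (Arrow (hb M Y)) (Arrow (dual_hb A W)); rewrite /= in SL.
rewrite !tA_cAl -?cA_assoc; [|dg..].
rewrite !tA_cAr -?cA_assoc; [|dg..].
rewrite -!tA_id in SL *; rewrite !tAA in SL *.
congr (_ ∙ _).
by rewrite cA_assoc ?SL -?cA_assoc; [|dg..].
Qed.

Lemma ihom_hb_unit M A : ihom_hb M A 𝟙 ≡ idm (cob M ⊗ (cob A)^∨).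
Proof. by arr; rewrite hb_unit dual_hb_unit !tA_id cA1a. Qed.

(** Rigidity supplies the inverse from the three axioms just shown, without inverting [dual_hb]. *)
Lemma ihom_hb_iso M A (Y : C) : is_iso (ihom_hb M A Y).
Proof.
apply: (@rigid_braiding_iso _ _ (ihom_hb M A)) => [Y1 Y2 f|Y1 Y2|].
- exact: ihom_hb_nat.
- exact: ihom_hb_tens.
- exact: ihom_hb_unit.
Qed.

Definition ihom M A : Z :=
  @CentreOb C (idSF C) (cob M ⊗ (cob A)^∨) (ihom_hb M A) (ihom_hb_iso M A)
    (@ihom_hb_nat M A) (fun Y W => @ihom_hb_tens M A Y W _).

Lemma ihomm_hb A M M' (f : hom M M') (Y : C) :
  ihom_hb M' A Y ∘ ((chom f ⊠ idm (cob A)^∨) ⊠ idm Y) =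
  (idm Y ⊠ (chom f ⊠ idm (cob A)^∨)) ∘ ihom_hb M A Y.
Proof.
have /(congr1 Arrow) := chom_hb f Y; arr => Hf; apply: arrow_inj; arr.
have := tA_slide (Arrow (chom f)) (Arrow (dual_hb A Y)) => /= SL.
rewrite -!tA_id in SL; rewrite !tAA -?cA_assoc; [|dg..].
by rewrite -[in LHS]tAA -SL cA_assoc ?tAA -?tA_cAl ?Hf ?tA_cAl -?cA_assoc; [|dg..].
Qed.

Definition ihomm A M M' (f : hom M M') : hom (ihom M A) (ihom M' A) :=
  @CentreHom C (idSF C) (ihom M A) (ihom M' A) _ (ihomm_hb A f).

(** Evaluation turns [dual_hb A Y] into [hb_inv A Y], which cancels against the half-braiding of the
    rightmost [A]. *)
Lemma ihom_counit_hb M A (Y : C) :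
  hb M Y ∘ (⟦ idm (cob M) ⊠ evl (cob A) ⟧ ⊠ idm (G Y)) =
  (idm Y ⊠ ⟦ idm (cob M) ⊠ evl (cob A) ⟧) ∘ act_hb (ihom M A) A Y.
Proof.
have K := hb_invK A Y.
have SL := tA_slide (Arrow (hb M Y)) (Arrow (evl (cob A))).
rewrite /= tAa1 in SL.
apply: arrow_inj; arr.
rewrite [iA Y ⋆ _]tAA tA_id tA_cAl -?[_ ⋆ iA _ ⋆ iA _]tAA ?tA_id; [|dg..].
rewrite -!cA_assoc; [|dg..].
rewrite [iA (Y ⊗ _) ⋆ _ ∙ _]cA_assoc -?SL -?cA_assoc; [|dg..].
congr (_ ∙ _).
rewrite -!tA_id -!tAA -!tA_cAr; [|dg..].
by rewrite [iA (G Y) ⋆ _ ∙ _]cA_assoc ?dual_hb_ev -?cA_assoc -?tA_cAr ?K ?tA_id ?cAa1; [|dg..].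
Qed.

Definition ihom_counit M A : hom (act (ihom M A) A) M :=
  @CentreHom C G (act (ihom M A) A) M _ (ihom_counit_hb M A).

Lemma ihom_unit_hb X A (Y : C) :
  ihom_hb (act X A) A Y ∘ (⟦ idm (cob X) ⊠ coevl (cob A) ⟧ ⊠ idm Y) =
  (idm Y ⊠ ⟦ idm (cob X) ⊠ coevl (cob A) ⟧) ∘ hb X Y.
Proof.
have K := hb_coev_dual_hb A Y.
have SL := tA_slide (Arrow (hb X Y)) (Arrow (coevl (cob A))).
rewrite /= tAa1 in SL.
apply: arrow_inj; arr.
rewrite tA_cAl -?tA_id -?tAA -?cA_assoc; [|dg..].
rewrite -!tA_cAr ?K; [|dg..].
by rewrite tA_id !tAA !tA_id /= SL.
Qed.

Definition ihom_unit X A : hom X (ihom (act X A) A) :=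
  @CentreHom C (idSF C) X (ihom (act X A) A) _ (ihom_unit_hb X A).

End InnerHomObject.

(** * Invertible objects and equivalences *)

Section CentreIso.
Variables (C : smcat) (G : smfunctor C C).

(** Cancelling the isomorphism [chom f ⊠ idm (G Y)] shows that the inverse in [C] also commutes with
    the half-braidings. *)
Lemma centre_iso (A B : centre G) (f : hom A B) : is_iso (chom f) -> is_iso f.
Proof.
move=> [g [gf fg]].
have gP Y : hb A Y ∘ (g ⊠ idm (G Y)) = (idm Y ⊠ g) ∘ hb B Y.
  have fI : is_iso (chom f ⊠ idm (G Y)).
    by apply: is_iso_tens (is_iso_id _); exists g.
  apply: (iso_epi fI); rewrite -!cmpA chom_hb -tensm_cmp gf cmp1m tensm_id.
  by rewrite cmpm1 cmpA -tensm_cmp gf cmp1m tensm_id cmp1m.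
by exists (CentreHom gP); split; apply: centre_hom_inj.
Qed.

Lemma chom_iso (A B : centre G) (f : hom A B) : is_iso f -> is_iso (chom f).
Proof.
by move=> [g [gf fg]]; exists (chom g); split;
  [move/(congr1 (@chom _ _ _ _)): gf | move/(congr1 (@chom _ _ _ _)): fg].
Qed.

Lemma chom_hcast (A A' B B' : centre G) (f : hom A B) (eA : A = A')
  (eB : B = B') : chom (hcast f eA eB : @hom (centre G) A' B') ≡ chom f.
Proof. by case: _ / eA; case: _ / eB. Qed.

End CentreIso.

(** Conjugating [idm W ⊠ f] by [p] gives [idm 𝟙 ⊠ f], which is [f] by strictness. *)
Lemma tens_unit_iso (C : smcat) (W X Y : C) (p : hom W 𝟙) (f : hom X Y) :
  is_iso p -> is_iso (idm W ⊠ f) -> is_iso f.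
Proof.
move=> pI fI; have [q [qp pq]] := pI.
have {fI} : is_iso ((p ⊠ idm Y) ∘ (idm W ⊠ f) ∘ (q ⊠ idm X)).
  apply: is_iso_cmp; first apply: is_iso_cmp => //.
    exact: is_iso_tens pI (is_iso_id _).
  by apply: is_iso_tens (is_iso_id _); exists p.
rewrite -!tensm_cmp cmpm1 pq cmp1m cmpm1 => fI.
have -> : f = hcast (idm 𝟙 ⊠ f) (tens1o X) (tens1o Y).
  by apply: arrow_inj; arr; rewrite tA1a.
exact: is_iso_hcast.
Qed.

(** By a snake identity [idm a ⊠ evl a] is a one-sided inverse of the isomorphism [coevl a ⊠ idm a],
    hence invertible. Tensoring with [b] on the left and contracting [b ⊗ a] along [p] leaves
    [evl a]. *)
Lemma invertible_of_coev (C : rigidcat) (a b : C) (p : hom (b ⊗ a) 𝟙) :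
  is_iso p -> is_iso (coevl a) -> invertible a.
Proof.
move=> pI cI; split=> //; apply: (tens_unit_iso pI).
have S1 := snakel1 a; move: S1; arr => S1.
pose k : hom (a ⊗ 𝟙) (a ⊗ (a^∨ ⊗ a)) := ⟦ coevl a ⊠ idm a ⟧.
have [k' [k'k kk']] : is_iso k.
  exact: is_iso_hcast (is_iso_tens cI (is_iso_id _)).
have ek : (idm a ⊠ evl a) ∘ k = idm _.
  by apply: arrow_inj; rewrite /k; arr; rewrite S1 tenso1.
have eI : is_iso (idm a ⊠ evl a).
  exists k; split=> //.
  have -> : idm a ⊠ evl a = k'.
    by rewrite -[LHS]cmpm1 -kk' cmpA ek cmp1m.
  by [].
have -> : idm (b ⊗ a) ⊠ evl a =
    ⟦ idm b ⊠ (idm a ⊠ evl a) ⟧.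
  by apply: arrow_inj; arr; rewrite tAA tA_id.
exact/is_iso_hcast/is_iso_tens/eI/is_iso_id.
Qed.

Section Equivalence.
Variables (C : strict_rigidcat) (A : antidrinfeld C).
Local Notation a := (cob (A : centre (bidualSF C))).

Lemma ihomm_id (M : antidrinfeld C) :
  ihomm A (idm M) = idm (ihom M A : drinfeld C).
Proof. by apply: centre_hom_inj; apply: tensm_id. Qed.

Lemma ihomm_cmp (M M' M'' : antidrinfeld C) (g : hom M' M'') (f : hom M M') :
  ihomm A (g ∘ f) = (ihomm A g : @hom (drinfeld C) _ _) ∘ ihomm A f.
Proof. by apply: centre_hom_inj; rewrite /= -tensm_cmp cmp1m. Qed.

Definition ihomF : functor (antidrinfeld C) (drinfeld C) :=
  @Functor (antidrinfeld C) (drinfeld C) (fun M => ihom M A)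
    (fun M M' f => ihomm A f) ihomm_id ihomm_cmp.

(** Unit and counit of the adjunction are [coevl a] and [evl a] tensored with identities, hence
    invertible in [C]; [centre_iso] lifts this to the centres. *)
Lemma invertible_equivalence :
  invertible a -> is_equivalence (rmulF (Z := drinfeld C) A).
Proof.
move=> [eI cI]; exists ihomF; split.
  have [_ + _] := nat_isoP (drinfeld C) (drinfeld C); apply.
  exists (fun X => ihom_unit X A); split=> [X Y f|X].
    have := tA_slide (Arrow (chom f)) (Arrow (coevl a)) => /= SL.
    apply/centre_hom_inj/arrow_inj => /=; arr.
    by rewrite -tAA tA_id SL tAa1.
  exact/centre_iso/is_iso_hcast/is_iso_tens/cI/is_iso_id.
exists (fun M => ihom_counit M A); split=> [X Y f|X].
  have := tA_slide (Arrow (chom f)) (Arrow (evl a)) => /= SL.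
  apply/centre_hom_inj/arrow_inj => /=; arr.
  by rewrite -tAA tA_id -SL tAa1.
exact/centre_iso/is_iso_hcast/is_iso_tens/eI/is_iso_id.
Qed.

(* Fullness lifts [id ⊗ ev : a ⊗ a^∨ ⊗ a -> a] to an inverse [g] of the
   coevaluation.  The half-braiding at [rdual a] is an isomorphism
   [a ⊗ a^∨ -> rdual a ⊗ a], so that [a] is also invertible on the other side. *)
Lemma full_faithful_invertible :
  full (rmulF (Z := drinfeld C) A) -> faithful (rmulF (Z := drinfeld C) A) ->
  invertible a.
Proof.
move=> Afull Afaith.
pose u : @hom (drinfeld C) 𝟙 (ihom A A) := hcast (ihom_unit (𝟙 : drinfeld C) A) erefl
  (congr1 (fun M => ihom M A) (act1 A)).
have uE : chom u ≡ coevl a.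
  apply: etrans (chom_hcast (ihom_unit (centre_unit C) A) _ _) _.
  by arr; rewrite tA1a.
have [g gE] := Afull (ihom A A : drinfeld C) 𝟙
  (hcast (ihom_counit A A) erefl (esym (act1 A))).
have {}gE : tA (Arrow (chom g)) (iA a) = tA (iA a) (Arrow (evl a)).
  apply: etrans (congr1 (fun h : centre_hom _ _ => Arrow (chom h)) gE) _.
  apply: etrans (chom_hcast (ihom_counit A A) _ _) _.
  by arr.
have S1 := snakel1 a; move: S1; arr => S1.
have S2 := snakel2 a; move: S2; arr => S2.
(* Faithfulness allows tensoring with [a], which replaces [g] by the evaluation and leaves a snake
   identity. *)
have gu : g ∘ u = idm (𝟙 : drinfeld C).
  apply: Afaith; apply/centre_hom_inj/arrow_inj => /=.
  arr; rewrite tA_cAl // uE gE.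
  by rewrite S1 tA1a.
have gcK : chom g ∘ coevl a = idm 𝟙.
  have := congr1 (fun h : centre_hom _ _ => Arrow (chom h)) gu.
  rewrite /= !arrow_cmp uE -arrow_cmp; exact: arrow_inj.
(* Sliding [g] past the coevaluation exposes [chom g ⊠ idm a]; by [gE] this is [idm a ⊠ evl a], and
   the snake identity on [a^∨] applies. *)
have cgK : coevl a ∘ chom g = idm (a ⊗ a^∨).
  have := tA_slide (Arrow (chom g)) (Arrow (coevl a)).
  rewrite /= tA1a tAa1 -!tA_id tAA => SL.
  apply: arrow_inj; rewrite arrow_cmp -SL gE -!tAA -tA_cAr ?S2 ?tA_id //; dg.
pose p : hom (a ⊗ (rdual a)^∨^∨) (rdual a ⊗ a) := hb A (rdual a).
have pI : is_iso p by exact: hb_iso.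
have [q [qp pq]] := pI.
(* Since [(rdual a)^∨ = a], the map [q] lands in [a ⊗ a^∨], where [chom g] continues to [𝟙]. *)
apply: (@invertible_of_coev _ a (rdual a)
  (chom g ∘ hcast q erefl (congr1 (fun X => a ⊗ X^∨) (rdualK a)))).
  apply: is_iso_cmp; last by apply: is_iso_hcast; exists p.
  by exists (coevl a).
by exists (chom g).
Qed.

End Equivalence.

(** * Quasi-pivotal structures as half-braidings *)

Section TransposeCalculus.
Variables (C : rigidcat) (b : C).
Local Notation e := (Arrow (evl b)).
Local Notation c := (Arrow (coevl b)).

Definition transpose (Q : C) (r : arrow C) : arrow C := iA Q ⋆ e ∙ r ⋆ iA b.

Lemma transposeK (Q : C) (t : arrow C) (P : C) :
  dom t = P ⊗ b -> cod t = Q -> transpose Q (t ⋆ iA b^∨ ∙ iA P ⋆ c) = t.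
Proof.
case: t => D Q' t /= ED EQ; subst D Q'; rewrite /transpose.
have S1 := snakel1 b; move: S1; arr => S1.
have := tA_slide (Arrow t) e; rewrite /= tAa1 => SL.
rewrite tA_cAl -?[_ ⋆ iA b^∨ ⋆ _]tAA ?tA_id; [|dg..].
rewrite cA_assoc -?SL -?cA_assoc; [|dg..].
by rewrite -tA_id -!tAA -tA_cAr ?S1 ?tA_id ?cAa1; [|dg..].
Qed.

Lemma transpose_cmp (Q : C) (r h : arrow C) :
  cod r = Q ⊗ b^∨ -> cod h = dom r ->
  transpose Q (r ∙ h) = transpose Q r ∙ h ⋆ iA b.
Proof. by move=> Er Eh; rewrite /transpose tA_cAl // cA_assoc //= ?Er ?Eh ?tensA. Qed.

(** The inner [evl b], coming from the monoidal structure of [b ⊗ - ⊗ b^∨], serves as the evaluation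
    that transposes [r1]. Thus monoidality of [qrho] becomes the tensor axiom of an inverse
    half-braiding. *)
Lemma transpose_tens (U V : C) (r1 r2 : arrow C) :
  cod r1 = b ⊗ U ⊗ b^∨ -> cod r2 = b ⊗ V ⊗ b^∨ ->
  transpose (b ⊗ U ⊗ V) (iA (b ⊗ U) ⋆ e ⋆ iA (V ⊗ b^∨) ∙ r1 ⋆ r2) =
  transpose (b ⊗ U) r1 ⋆ iA V ∙ iA (dom r1) ⋆ transpose (b ⊗ V) r2.
Proof.
case: r1 r2 => [P1 Q1 r1] [P2 Q2 r2] /= E1 E2; subst Q1 Q2; rewrite /transpose.
rewrite !tA_cAl; [|dg..].
rewrite !tA_cAr; [|dg..].
have SL := tA_slide (Arrow r1) (iA (b ⊗ V) ⋆ e); rewrite /= tenso1 in SL.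
have := tA_slide e (iA V ⋆ e); rewrite /= tA1a tenso1 => SL'.
rewrite -[RHS]cA_assoc; [|dg..].
rewrite [Arrow r1 ⋆ iA b ⋆ iA V ∙ _]cA_assoc; [|dg..].
rewrite -[Arrow r1 ⋆ iA b ⋆ iA V]tAA tA_id SL.
have RR : Arrow r1 ⋆ iA (b ⊗ V ⊗ (b^∨ ⊗ b)) ∙ iA P1 ⋆ (Arrow r2 ⋆ iA b) =
    Arrow r1 ⋆ Arrow r2 ⋆ iA b.
  by rewrite -tA_cA ?cAa1 ?cA1a ?tAA; [|dg..].
rewrite -[in RHS]cA_assoc ?RR; [|dg..].
rewrite !cA_assoc; [|dg..].
congr (_ ∙ _); rewrite -!tA_id -!tAA -!tA_cAr; [|dg..].
by congr (_ ⋆ (_ ⋆ _)); rewrite !tA_id !tAA !tA_id in SL' *.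
Qed.
End TransposeCalculus.

(** By [ldualm_ev], [ldualm psi] before [evl b'] equals [psi] before [evl b], and [psi] then slides
    past [r]. *)
Lemma transpose_dual (C : rigidcat) (b b' Q Q' : C) (g r : arrow C)
  (psi : hom b' b) : cod r = Q ⊗ b^∨ -> dom g = Q -> cod g = Q' ->
  transpose b' Q' (g ⋆ Arrow (ldualm psi) ∙ r) =
  g ∙ transpose b Q r ∙ iA (dom r) ⋆ Arrow psi.
Proof.
case: g r => [Q1 Q1' g] [P R r] /= E1 E2 E3; subst R Q1 Q1'; rewrite /transpose.
have /(congr1 Arrow) := ldualm_ev psi.
move: (ldualm psi) => phi; arr => EV.
have := tA_slide (Arrow g) (Arrow (evl b')); rewrite /= tAa1 => SL.
have := tA_slide (Arrow r) (Arrow psi); rewrite /= => SL'.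
rewrite -[Arrow g ⋆ _](cAa1 (X := Q ⊗ b^∨)) // -tA_id.
have -> : Arrow g ⋆ Arrow phi = Arrow g ⋆ iA b'^∨ ∙ iA Q ⋆ Arrow phi.
  by rewrite -tA_cA // cAa1 // cA1a.
rewrite !tA_cAl -?cA_assoc ?tA_id ?cAa1; [|dg..].
rewrite -[Arrow g ⋆ _ ⋆ _]tAA tA_id cA_assoc -?SL -?cA_assoc; [|dg..].
congr (_ ∙ _).
rewrite SL' cA1a ?cA_assoc -?tAA -?tA_cAr ?EV; [|dg..].
by rewrite -tA_id -tAA tA_cAr; [|dg..].
Qed.

Section CentreHomInverse.
Variables (C : smcat) (G : smfunctor C C).

Lemma chom_hb_inv (A B : centre G) (f : hom (cob A) (cob B)) :
  (forall Y, hb B Y ∘ (f ⊠ idm (G Y)) = (idm Y ⊠ f) ∘ hb A Y) <->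
  (forall Y, (f ⊠ idm (G Y)) ∘ hb_inv A Y = hb_inv B Y ∘ (idm Y ⊠ f)).
Proof.
split=> H Y; have [sh hs] := hb_invP A Y; have [sh' hs'] := hb_invP B Y.
  rewrite -[LHS]cmp1m -sh' -cmpA; congr (_ ∘ _).
  by rewrite cmpA H -cmpA hs cmpm1.
rewrite -[RHS]cmp1m -hs' -cmpA; congr (_ ∘ _).
by rewrite cmpA -H -cmpA sh cmpm1.
Qed.

(** Both sides invert [inv_braiding]; since [hb_inv] is a choice, uniqueness of inverses is
    invoked. *)
Lemma inverse_centre_hb_inv (A : C) s s_iso s_nat s_tens (Y : C) :
  hb_inv (@inverse_centre_ob C G A s s_iso s_nat s_tens) Y = s Y.
Proof.
have [h1 h2] := hb_invP (@inverse_centre_ob C G A s s_iso s_nat s_tens) Y.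
have [h3 h4] := inv_braidingP s_iso Y.
exact: (inverses_uniq (conj h1 h2) (conj h4 h3)).
Qed.

End CentreHomInverse.

Section QuasiPivotal.
Variable C : strict_rigidcat.
Local Notation G := (bidualSF C).

(** * From quasi-pivotal structures to the anti-centre *)

Section ToCentre.
Variable P : quasi_pivotal C.
Local Notation b := (qbeta P).

Definition qhb_inv (X : C) : hom (X ⊗ b) (b ⊗ G X) :=
  ⟦ (idm (b ⊗ G X) ⊠ evl b) ⊚ ((qrho P X : hom X (b ⊗ G X ⊗ b^∨)) ⊠ idm b) ⟧.

Lemma qhb_invE (X : C) : Arrow (qhb_inv X) = transpose b (b ⊗ G X) (Arrow (qrho P X)).
Proof. by rewrite /transpose; arr. Qed.

Lemma qhb_inv_iso (X : C) : is_iso (qhb_inv X).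
Proof.
have [eI _] := qbeta_invertible P.
apply/is_iso_hcast/is_iso_cmp.
  exact: is_iso_tens (is_iso_id _) eI.
exact/is_iso_hcast/is_iso_tens/is_iso_id/qrho_iso.
Qed.

Lemma qhb_inv_nat (X Y : C) (f : hom X Y) :
  (idm b ⊠ fmap G f) ∘ qhb_inv X = qhb_inv Y ∘ (f ⊠ idm b).
Proof.
have /(congr1 Arrow) := qrho_nat P f; rewrite !arrow_cmp !arrow_tens => E.
apply: arrow_inj; rewrite !arrow_cmp !qhb_invE !arrow_tens.
rewrite -[Arrow (idm b)]/(iA b) -transpose_cmp // E.
(* Writing the identity of [b^∨] as a dual morphism brings the goal under [transpose_dual] with
   [psi] the identity. *)
rewrite -[Arrow (idm b)]/(iA b) -[idm b^∨]ldualm_id.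
have H := @transpose_dual C b b (b ⊗ G X) (b ⊗ G Y) (iA b ⋆ Arrow (fmap G f))
  (Arrow (qrho P X)) (idm b) erefl erefl erefl.
apply: etrans (esym H); rewrite tA_id cAa1 //; dg.
Qed.

Lemma qhb_inv_tens (X Y : C) :
  qhb_inv (X ⊗ Y) ≡ (qhb_inv X ⊠ idm (G Y)) ⊚ (idm X ⊠ qhb_inv Y).
Proof.
rewrite qhb_invE qrho_tens; arr.
have -> : b ⊗ G (X ⊗ Y) = b ⊗ G X ⊗ G Y by rewrite sm_tens tensA.
have := @transpose_tens C b (G X) (G Y) (Arrow (qrho P X)) (Arrow (qrho P Y)) erefl erefl.
by rewrite /transpose -?tA_id ?tAA; apply.
Qed.

Definition qcentre : centre G := inverse_centre_ob qhb_inv_iso qhb_inv_nat qhb_inv_tens.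

End ToCentre.

(** Transposing the equivalence relation with [transpose_dual] says that [psiV], rather than [psi],
    commutes with the inverse half-braidings; so [psiV] is the isomorphism in the anti-centre. *)
Lemma qcentre_equiv (P P' : quasi_pivotal C) :
  quasi_pivotal_equiv P P' <-> isomorphic (qcentre P) (qcentre P').
Proof.
have key (psi : hom (qbeta P') (qbeta P)) (psiV : hom (qbeta P) (qbeta P')) X :
    inverses psi psiV ->
    qrho P' X = (psiV ⊠ idm X^∨^∨ ⊠ ldualm psi) ∘ qrho P X <->
    (psiV ⊠ idm (G X)) ∘ qhb_inv P X = qhb_inv P' X ∘ (idm X ⊠ psiV).
  move=> [psiVK psiK].
  have T := @transpose_dual C _ _ (qbeta P ⊗ G X) (qbeta P' ⊗ G X)
    (Arrow psiV ⋆ iA (G X)) (Arrow (qrho P X)) psi erefl erefl erefl.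
  have -> : ((psiV ⊠ idm (G X)) ∘ qhb_inv P X = qhb_inv P' X ∘ (idm X ⊠ psiV)) <->
     ((psiV ⊠ idm (G X)) ∘ qhb_inv P X ∘ (idm X ⊠ psi) = qhb_inv P' X).
    split=> [->|<-].
      by rewrite -cmpA -tensm_cmp psiVK cmp1m tensm_id cmpm1.
    by rewrite -[RHS]cmpA -tensm_cmp psiK cmp1m tensm_id cmpm1.
  split=> [E|E]; apply: arrow_inj.
    rewrite qhb_invE E !arrow_cmp qhb_invE !arrow_tens; exact: esym T.
  apply: (@transpose_inj C (qbeta P') (qbeta P' ⊗ G X)) => //.
  apply: etrans (esym (qhb_invE P' X)) _.
  rewrite -E !arrow_cmp qhb_invE !arrow_tens; exact: esym T.
split=> [[psi [psiV [I H]]]|[f fI]].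
  have I' : is_iso psiV by exists psi; case: I.
  have fP : forall Y, (psiV ⊠ idm (G Y)) ∘ hb_inv (qcentre P) Y =
      hb_inv (qcentre P') Y ∘ (idm Y ⊠ psiV).
    by move=> Y; rewrite !inverse_centre_hb_inv; apply/(key _ _ _ I)/H.
  have hP := (@chom_hb_inv _ _ (qcentre P) (qcentre P') psiV).2 fP.
  by exists (CentreHom hP); apply: centre_iso.
have [g [gf fg]] := chom_iso fI.
exists g, (chom f); split=> [|X]; first by split.
apply/(key _ _ _ (conj fg gf)).
have := (@chom_hb_inv _ _ (qcentre P) (qcentre P') (chom f)).1 (chom_hb f) X.
by rewrite !inverse_centre_hb_inv.
Qed.

(** * From invertible objects of the anti-centre to quasi-pivotal structures *)

Section FromCentre.
Variables (A : centre G).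
Local Notation a := (cob A).
Hypothesis aI : invertible a.

Definition crho (X : C) : hom X (a ⊗ X^∨^∨ ⊗ a^∨) :=
  ⟦ ((hb_inv A X : hom (X ⊗ a) (a ⊗ X^∨^∨)) ⊠ idm a^∨) ⊚ (idm X ⊠ coevl a) ⟧.

(** Together with [transpose_inj], this reduces naturality and monoidality of [crho] to the
    corresponding laws of [hb_inv]. *)
Lemma transpose_crho (X : C) : transpose a (a ⊗ G X) (Arrow (crho X)) = Arrow (hb_inv A X).
Proof.
by arr; apply: (@transposeK C a (a ⊗ G X) (Arrow (hb_inv A X)) X).
Qed.

Lemma crho_iso (X : C) : is_iso (crho X).
Proof.
have [_ cI] := aI; apply/is_iso_hcast/is_iso_cmp; last first.
  exact/is_iso_hcast/is_iso_tens/cI/is_iso_id.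
apply: is_iso_tens (is_iso_id _); exists (hb A X).
by have [] := hb_invP A X.
Qed.

Lemma crho_nat (X Y : C) (f : hom X Y) :
  crho Y ∘ f = (idm a ⊠ fmap (bidualF C) f ⊠ idm a^∨) ∘ crho X.
Proof.
apply/arrow_inj/(@transpose_inj C a (a ⊗ G Y)) => //.
rewrite arrow_cmp [LHS](transpose_cmp (Q := a ⊗ G Y)) // transpose_crho.
rewrite !arrow_cmp !arrow_tens -[idm a^∨]ldualm_id.
have H := @transpose_dual C a a (a ⊗ G X) (a ⊗ G Y) (iA a ⋆ Arrow (fmap G f))
  (Arrow (crho X)) (idm a) erefl erefl erefl.
apply: etrans _ (esym H); rewrite transpose_crho tA_id cAa1; last by dg.
by have /(congr1 Arrow) := hb_inv_nat A f; rewrite !arrow_cmp !arrow_tens.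
Qed.

Lemma crho_tens (X Y : C) :
  crho (X ⊗ Y) ≡
  (idm a ⊠ idm X^∨^∨ ⊠ evl a ⊠ idm Y^∨^∨ ⊠ idm a^∨) ⊚ (crho X ⊠ crho Y).
Proof.
have GE : G (X ⊗ Y) = G X ⊗ G Y by exact: sm_tens.
rewrite arrow_cmpE !arrow_tens.
apply: (@transpose_inj C a (a ⊗ G X ⊗ G Y)).
- by rewrite -[a ⊗ G X ⊗ G Y]tensA -GE.
- by rewrite cod_cA //; dg.
- by rewrite dom_cA //; dg.
have := @transpose_tens C a (G X) (G Y) (Arrow (crho X)) (Arrow (crho Y)) erefl erefl.
rewrite !transpose_crho /= => T.
rewrite -[a ⊗ G X ⊗ G Y]tensA -GE [LHS]transpose_crho hb_inv_tens arrow_cmpE !arrow_tens.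
apply: etrans (esym T) _; rewrite /transpose GE tensA -!tA_id !tAA.
by [].
Qed.

Lemma crho_unit : crho 𝟙 ≡ coevl a.
Proof. by arr; rewrite hb_inv_unit tA_id tA1a cA1a. Qed.

Definition cquasi_pivotal : quasi_pivotal C :=
  QuasiPivotal aI crho_iso crho_nat crho_tens crho_unit.

(** The underlying objects coincide and transposing [crho] gives back [hb_inv A], so the identity of
    [a] is an isomorphism. *)
Lemma qcentreK : isomorphic (qcentre cquasi_pivotal) A.
Proof.
have H (Y : C) : (idm a ⊠ idm (G Y)) ∘ hb_inv (qcentre cquasi_pivotal) Y =
    hb_inv A Y ∘ (idm Y ⊠ idm a).
  rewrite inverse_centre_hb_inv !tensm_id cmp1m cmpm1; apply: arrow_inj.
  by rewrite qhb_invE transpose_crho.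
have hP := (@chom_hb_inv _ _ (qcentre cquasi_pivotal) A (idm a)).2 H.
by exists (CentreHom hP); apply: centre_iso; apply: is_iso_id.
Qed.

End FromCentre.

End QuasiPivotal.

(** * Assembling the two bijections *)

Theorem theorem4p15 (C : strict_rigidcat) :
  (exists f : QPiv C -> Pic C, bijective f) /\
  (exists g : Pic C -> ModEquiv C, bijective g).
Proof.
have PicP : is_equiv_rel (fun A B : {A : centre (bidualSF C) | invertible (cob A)} =>
    isomorphic (sval A) (sval B)).
  have [r s t] := isomorphicP (centre (bidualSF C)).
  by split=> [[A ?]|[A ?] [B ?]|[A ?] [B ?] [D ?]] /=;
    [exact: r | exact: s | exact: t].
have qI (P : quasi_pivotal C) : invertible (cob (qcentre P)).
  exact: qbeta_invertible.
split.
  apply: (quotient_bij (h := fun P => exist _ (qcentre P) (qI P))) => //.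
  - exact: quasi_pivotal_equivP.
  - exact: qcentre_equiv.
  - by move=> [A aI]; exists (cquasi_pivotal aI); apply: qcentreK.
have aE (A : {A : centre (bidualSF C) | invertible (cob A)}) :
    is_equivalence (rmulL (Z := drinfeld C) (N := antidrinfeld C) (sval A)).
  by apply: invertible_equivalence; case: A.
have MP : is_equiv_rel
    (fun F G : lmod_equivalence (regular (drinfeld C)) (antidrinfeld C) =>
      nat_iso F G).
  have [r s t] := nat_isoP (drinfeld C) (antidrinfeld C).
  by split=> [F|F G|F G H]; [exact: r | exact: s | exact: t].
apply: (quotient_bij (h := fun A => LModEquivalence (aE A))) => //.
- by move=> A B; apply: iff_sym; apply: (rmul_isomorphic (Z := drinfeld C)).
(* The preimage of [F] is [F 𝟙]: right multiplication by it is isomorphic to [F], hence full and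
   faithful, which forces [F 𝟙] to be invertible in [C]. *)
move=> [F FE] /=.
have FR := lmod_functor_rmul F.
have RF : nat_iso (rmulF (F 𝟙)) F.
  by have [_ + _] := nat_isoP (drinfeld C) (antidrinfeld C); apply.
have AI : invertible (cob (F 𝟙 : centre (bidualSF C))).
  apply: full_faithful_invertible.
    exact: nat_iso_full RF (equivalence_full FE).
  exact: nat_iso_faithful RF (equivalence_faithful FE).
by exists (exist _ (F 𝟙 : centre (bidualSF C)) AI).
Qed.
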